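(* Let $n\ge 3$, let $(S^n,g_0)$ be the standard sphere, and let $\Lambda_k=\{p_1,p_2,\dots,p_k\}\subset S^n$ be a set of $k$ points with $k>2$. Then any complete metric $\bar g$ of positive constant scalar curvature on $S^n\setminus\Lambda_k$ which is conformal to the standard metric $g_0$ has a non-parallel Ricci tensor, except for the standard one.
   Context: A metric $\bar g$ on $S^n\setminus\Lambda_k$ is conformal to $g_0$ if $\bar g=u^{\frac{4}{n-2}}g_0$ for a smooth positive function $u$ on $S^n\setminus\Lambda_k$. The Ricci tensor of $\bar g$ is parallel if $D\,\mathrm{Ric}=0$, where $D$ is the Levi-Civita connection of $\bar g$, and non-parallel otherwise. *)

(* Defs.v *)
From mathcomp Require Import all_boot all_order all_algebra.
From mathcomp Require Import all_classical all_reals all_analysis.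

Set Implicit Arguments.
Unset Strict Implicit.
Unset Printing Implicit Defensive.

Import Order.TTheory GRing.Theory Num.Theory.
Import numFieldNormedType.Exports.

Local Open Scope classical_set_scope.
Local Open Scope ring_scope.

(* The library topology on 'rV[R]_n comes from the sup norm; Euclidean lengths
   are always taken through [dot]. *)
Definition dot (R : realType) (m : nat) (v w : 'rV[R]_m) : R :=
  \sum_i v 0 i * w 0 i.

Definition partial (R : realType) (n : nat) (i : 'I_n)
    (f : 'rV[R]_n -> R) (x : 'rV[R]_n) : R :=
  'D_(delta_mx 0 i) f x.

(* C^oo on an open set U: all iterated partial derivatives are differentiable
   (hence continuous) at every point of U. *)
Definition smooth_on (R : realType) (n : nat) (U : set 'rV[R]_n)
    (f : 'rV[R]_n -> R) : Prop :=
  forall (s : seq 'I_n) (x : 'rV[R]_n), U x ->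
    differentiable (foldr (@partial R n) f s) x.

(** * Curvature in local coordinates *)

(* A metric or a (0,2)-tensor on an open subset of R^n is given by its matrix
   of components h x i j. *)

Definition christoffel (R : realType) (n : nat) (h : 'rV[R]_n -> 'M[R]_n)
    (k i j : 'I_n) (x : 'rV[R]_n) : R :=
  2^-1 * \sum_l invmx (h x) k l *
    (partial i (fun y => h y j l) x + partial j (fun y => h y i l) x
     - partial l (fun y => h y i j) x).

(* R(d_i, d_j) d_k = \sum_l riemann h l k i j d_l *)
Definition riemann (R : realType) (n : nat) (h : 'rV[R]_n -> 'M[R]_n)
    (l k i j : 'I_n) (x : 'rV[R]_n) : R :=
  partial i (christoffel h l j k) x - partial j (christoffel h l i k) x
  + \sum_m (christoffel h l i m x * christoffel h m j k x
            - christoffel h l j m x * christoffel h m i k x).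

(* Ric(Y, Z) is the trace of X |-> R(X, Y) Z; round spheres have Ric > 0. *)
Definition ricci (R : realType) (n : nat) (h : 'rV[R]_n -> 'M[R]_n)
    (x : 'rV[R]_n) : 'M[R]_n :=
  \matrix_(i, j) \sum_l riemann h l j l i x.

Definition scalar_curvature (R : realType) (n : nat)
    (h : 'rV[R]_n -> 'M[R]_n) (x : 'rV[R]_n) : R :=
  \sum_i \sum_j invmx (h x) i j * ricci h x i j.

(* Component (D_(d_m) T)(d_i, d_j), for D the Levi-Civita connection of h. *)
Definition covariant_derivative (R : realType) (n : nat)
    (h T : 'rV[R]_n -> 'M[R]_n) (m i j : 'I_n) (x : 'rV[R]_n) : R :=
  partial m (fun y => T y i j) x
  - \sum_l (christoffel h l m i x * T x l j + christoffel h l m j x * T x i l).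

(** * The sphere *)

(* S^n as a subset of R^(n+1) *)
Definition sphere (R : realType) (n : nat) : set 'rV[R]_n.+1 :=
  [set p | dot p p = 1].
Arguments sphere : clear implicits.

Definition tangent (R : realType) (n : nat) (p : 'rV[R]_n.+1) :
    set 'rV[R]_n.+1 :=
  [set v | dot p v = 0].

(* The two inverse stereographic projections R^n -> S^n; their images are the
   complements of e_0 (b = false) and of -e_0 (b = true), so their inverses
   form an atlas of the smooth manifold S^n. *)
Definition stereo (R : realType) (n : nat) (b : bool) (x : 'rV[R]_n) :
    'rV[R]_n.+1 :=
  (dot x x + 1)^-1 *:
    (row_mx (((-1) ^+ b * (dot x x - 1))%:M : 'rV_1) (2 *: x) : 'rV_(1 + n)).

Definition smooth_on_sphere (R : realType) (n : nat) (M : set 'rV[R]_n.+1)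
    (u : 'rV[R]_n.+1 -> R) : Prop :=
  forall b : bool, smooth_on (stereo b @^-1` M) (u \o stereo b).

(* A field of bilinear forms on the tangent spaces of an open part M of S^n is
   given by a function g p v w; only its values for p in M and v, w tangent at
   p are meaningful. *)
Definition tensor_field (R : realType) (n : nat) : Type :=
  'rV[R]_n.+1 -> 'rV[R]_n.+1 -> 'rV[R]_n.+1 -> R.
Arguments tensor_field : clear implicits.

Definition tensor_eq_on (R : realType) (n : nat) (M : set 'rV[R]_n.+1)
    (g h : tensor_field R n) : Prop :=
  forall p v w, M p -> tangent p v -> tangent p w -> g p v w = h p v w.

(* g_0, induced by the Euclidean metric of R^(n+1) *)
Definition standard_metric (R : realType) (n : nat) : tensor_field R n :=
  fun _ v w => dot v w.
Arguments standard_metric : clear implicits.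

Definition conformal_to_standard (R : realType) (n : nat)
    (M : set 'rV[R]_n.+1) (g : tensor_field R n) : Prop :=
  exists u : 'rV[R]_n.+1 -> R,
    [/\ smooth_on_sphere M u,
        forall p, M p -> 0 < u p &
        tensor_eq_on M g (fun p v w =>
          (u p `^ (4 / (n%:R - 2))) * standard_metric R n p v w)].

(* Components of g in a stereographic chart. *)
Definition in_chart (R : realType) (n : nat) (g : tensor_field R n) (b : bool)
    (x : 'rV[R]_n) : 'M[R]_n :=
  \matrix_(i, j) g (stereo b x) ('D_(delta_mx 0 i) (stereo b) x)
                                ('D_(delta_mx 0 j) (stereo b) x).

Definition has_constant_scalar_curvature (R : realType) (n : nat)
    (M : set 'rV[R]_n.+1) (g : tensor_field R n) (c : R) : Prop :=
  forall (b : bool) (x : 'rV[R]_n), M (stereo b x) ->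
    scalar_curvature (in_chart g b) x = c.

Definition parallel_ricci (R : realType) (n : nat)
    (M : set 'rV[R]_n.+1) (g : tensor_field R n) : Prop :=
  forall (b : bool) (x : 'rV[R]_n), M (stereo b x) ->
    forall m i j : 'I_n,
      covariant_derivative (in_chart g b) (ricci (in_chart g b)) m i j x = 0.

(** * Completeness *)

(* c is C^1 on the closed interval [a, b], in the one-sided sense at the
   endpoints, iff it agrees there with a C^1 map on the whole line. *)
Definition C1_on (R : realType) (m : nat) (a b : R) (c : R -> 'rV[R]_m.+1) :
    Prop :=
  exists d : R -> 'rV[R]_m.+1,
    [/\ forall t, derivable d t 1,
        continuous (derive1 d) &
        forall t, a <= t <= b -> c t = d t].

Definition piecewise_C1 (R : realType) (m : nat) (c : R -> 'rV[R]_m.+1) :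
    Prop :=
  exists s : seq R,
    [/\ path <%R 0 s, last 0 s = 1 &
        forall i, (i < size s)%N ->
          C1_on (nth 0 (0 :: s) i) (nth 0 (0 :: s) i.+1) c].

Definition curve_in (R : realType) (n : nat) (M : set 'rV[R]_n.+1)
    (p q : 'rV[R]_n.+1) (c : R -> 'rV[R]_n.+1) : Prop :=
  [/\ piecewise_C1 c, forall t, 0 <= t <= 1 -> M (c t), c 0 = p & c 1 = q].

(* The velocity is a junk value at finitely many times only. *)
Definition curve_length (R : realType) (n : nat) (g : tensor_field R n)
    (c : R -> 'rV[R]_n.+1) : \bar R :=
  (\int[lebesgue_measure]_(t in `[0%R, 1%R])
     (Num.sqrt (g (c t) (derive1 c t) (derive1 c t)))%:E)%E.

Definition riemannian_distance (R : realType) (n : nat)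
    (M : set 'rV[R]_n.+1) (g : tensor_field R n) (p q : 'rV[R]_n.+1) : \bar R :=
  ereal_inf [set curve_length g c | c in curve_in M p q].

(* Every Cauchy sequence of M for the Riemannian distance converges in M. *)
Definition complete_metric (R : realType) (n : nat)
    (M : set 'rV[R]_n.+1) (g : tensor_field R n) : Prop :=
  forall x : nat -> 'rV[R]_n.+1,
    (forall i, M (x i)) ->
    (forall e : R, 0 < e -> exists N : nat, forall i j : nat,
       (N <= i)%N -> (N <= j)%N ->
       (riemannian_distance M g (x i) (x j) < e%:E)%E) ->
    exists2 l, M l &
      forall e : R, 0 < e -> exists N : nat, forall i : nat,
        (N <= i)%N -> (riemannian_distance M g (x i) l < e%:E)%E.

(* Main.v *)
Require Import Defs.
From mathcomp Require Import all_boot all_order all_algebra.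
From mathcomp Require Import all_classical all_reals all_analysis.
From mathcomp Require Import measurable_realfun ring lra.

(** Write the metric in the stereographic chart as f^-1 times the Euclidean
metric. The Ricci tensor of a conformally flat metric is an explicit expression
in the first two derivatives of the conformal factor, and with this choice of f
the equation D Ric = 0 collapses to a linear one: the totally symmetric tensor of
third derivatives of f is pure trace, f_mij = d_mi t_j + d_mj t_i + d_ij t_m, where
d is the Kronecker symbol [parallel_third_derivatives]. In dimension at least
three this overdetermined equation can be integrated on the complement of
finitely many points, which is connected: f is a quadratic form in 1, x, |x|^2
[quartic_form]. On the sphere this says that the reciprocal q of the conformal
factor is the restriction of a polynomial of degree at most two
[conformal_factor_quadratic].

Completeness forces q to vanish at every puncture [complete_zero]. If
q (p i) <> 0, the conformal factor is bounded near p i, so points marching into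
p i along an arc form a Cauchy sequence for the Riemannian distance. On the other
hand q is bounded on the sphere, so the conformal factor is bounded below and the
Riemannian distance dominates the distance of coordinates [coord_le_distance]: a
limit of that sequence could only be p i, which has been removed.

So q is a polynomial of degree at most two, nonnegative on the sphere, vanishing
exactly on a finite set with at least three points. On the circle through three
of them q is a trigonometric polynomial of degree two with three double zeros,
hence zero; it is enough to see that its zeros cluster at one of the three
points [zeros_cluster], which contradicts finiteness. *)

Set Implicit Arguments.
Unset Strict Implicit.
Unset Printing Implicit Defensive.

Import Order.TTheory GRing.Theory Num.Theory.
Import numFieldNormedType.Exports.

Local Open Scope classical_set_scope.
Local Open Scope ring_scope.

(** * Mixed derivatives commute *)

Lemma dist_le_half (R : realFieldType) (a b c e : R) :
  `|a - c| < e / 2 -> `|b - c| < e / 2 -> `|a - b| <= e.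
Proof.
by rewrite !ltr_norml ler_norml => /andP[? ?] /andP[? ?]; apply/andP; split; lra.
Qed.

Section Lines.
Variables (R : realType) (n : nat).
Implicit Types (x v w : 'rV[R]_n) (f : 'rV[R]_n -> R).

Lemma is_diff_affine_line x v (t : R) :
  is_diff t (fun s : R => x + s *: v) ( *:%R^~ v).
Proof.
have -> : (fun s : R => x + s *: v) = cst x + ( *:%R^~ v).
  by apply/funext => s.
have h := @is_diffD R R 'rV[R]_n (cst x) ( *:%R^~ v) 0 ( *:%R^~ v) t
  (is_diff_cst _ _) (is_diff_scalel _ _).
by apply: (is_diff_eq h); rewrite add0r.
Qed.

Lemma is_derive_line f x v t : differentiable f (x + t *: v) ->
  is_derive t 1 (fun s : R => f (x + s *: v)) ('D_v f (x + t *: v)).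
Proof.
move=> df; have dl := is_diff_affine_line x v t.
have dfl : differentiable (f \o (fun s : R => x + s *: v)) t.
  by apply: differentiable_comp => //.
split; first exact: diff_derivable.
rewrite deriveE // diff_comp //= deriveE //.
by rewrite diff_val /= scale1r.
Qed.

Lemma line_MVT f x v h : 0 < h ->
  (forall s, 0 <= s <= h -> differentiable f (x + s *: v)) ->
  exists2 s, 0 < s < h & f (x + h *: v) - f x = h * 'D_v f (x + s *: v).
Proof.
move=> h0 df.
have dl s : s \in `]0, h[ -> is_derive s 1 (fun s : R => f (x + s *: v))
    ('D_v f (x + s *: v)).
  rewrite in_itv /= => /andP[s0 sh].
  by apply: is_derive_line; apply: df; rewrite !ltW.
have := @MVT R (fun s : R => f (x + s *: v)) (fun s => 'D_v f (x + s *: v)) 0 h h0 dl.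
case.
  apply: continuous_in_subspaceT => s; rewrite inE /= in_itv /= => sh.
  apply: differentiable_continuous; apply/derivable1_diffP.
  by case: (is_derive_line (df s sh)).
move=> s; rewrite in_itv /= => sh; rewrite scale0r addr0 subr0 => ->.
by exists s => //; rewrite mulrC.
Qed.

Lemma derive_shift_arg f a v x : differentiable f (x + a) ->
  differentiable (fun y => f (y + a)) x /\
  'D_v (fun y => f (y + a)) x = 'D_v f (x + a).
Proof.
move=> df.
have da : is_diff x (fun y => y + a) id.
  have -> : (fun y => y + a) = id + cst a by apply/funext.
  have h := @is_diffD R 'rV[R]_n 'rV[R]_n id (cst a) id 0 x
    (is_diff_id _) (is_diff_cst _ _).
  by apply: (is_diff_eq h); rewrite addr0.
have dc : differentiable (f \o (fun y => y + a)) x by apply: differentiable_comp.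
split => //.
rewrite deriveE // diff_comp // deriveE //=.
by rewrite diff_val.
Qed.

(** The mean value theorem, first in the direction v for y |-> f (y + h w) - f y and
then in the direction w for the derivative of f along v. *)
Lemma second_difference f (U : set 'rV[R]_n) x v w h : 0 < h ->
  (forall s t, 0 <= s <= h -> 0 <= t <= h -> U (x + s *: v + t *: w)) ->
  (forall y, U y -> differentiable f y) ->
  (forall y, U y -> differentiable ('D_v f) y) ->
  exists s t, [/\ 0 < s < h, 0 < t < h &
    f (x + h *: v + h *: w) - f (x + h *: v) - f (x + h *: w) + f x
      = h ^+ 2 * 'D_w ('D_v f) (x + s *: v + t *: w)].
Proof.
move=> h0 hU df dvf.
have h0h : 0 <= h <= h by rewrite lexx ltW.
have h00 : 0 <= (0:R) <= h by rewrite lexx ltW.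
pose F y := f (y + h *: w) - f y.
have dF s : 0 <= s <= h -> differentiable F (x + s *: v) /\
    'D_v F (x + s *: v) = 'D_v f (x + s *: v + h *: w) - 'D_v f (x + s *: v).
  move=> sh.
  have [d1 e1] := derive_shift_arg v (df _ (hU s h sh h0h)).
  have d2 : differentiable f (x + s *: v).
    by rewrite -[_ + _]addr0 -(scale0r w); apply/df/hU.
  split; first exact: differentiableB.
  by rewrite deriveB ?e1 //; exact: diff_derivable.
have [s /andP[s0 sh]] := line_MVT h0 (fun s sh => (dF s sh).1).
have sh' : 0 <= s <= h by rewrite !ltW.
rewrite (dF s sh').2 => eF.
have [t th et] := @line_MVT ('D_v f) (x + s *: v) w h h0
  (fun t th => dvf _ (hU s t sh' th)).
exists s, t; split; rewrite ?s0 //.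
rewrite exprS expr1 -mulrA -et -eF /F addrAC.
by ring.
Qed.

(** The second difference quotient of f is symmetric in v and w, and by
[second_difference] it is a value of either mixed derivative at a point close to
x; continuity identifies the limits. *)
Lemma derive_comm f (U : set 'rV[R]_n) x v w : open U -> U x ->
  (forall y, U y -> differentiable f y) ->
  (forall y, U y -> differentiable ('D_v f) y) ->
  (forall y, U y -> differentiable ('D_w f) y) ->
  {for x, continuous ('D_w ('D_v f))} ->
  {for x, continuous ('D_v ('D_w f))} ->
  'D_w ('D_v f) x = 'D_v ('D_w f) x.
Proof.
move=> oU Ux df dv dw cwv cvw.
apply/eqP; rewrite -subr_eq0 -normr_le0; apply/ler_addgt0Pr => e e0; rewrite add0r.
have nU : nbhs x U by exact: open_nbhs_nbhs.
have e2 : 0 < (e : R) / 2 by rewrite divr_gt0.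
pose A (y : 'rV[R]_n) := `|'D_w ('D_v f) x - 'D_w ('D_v f) y| < e / 2.
pose B (y : 'rV[R]_n) := `|'D_v ('D_w f) x - 'D_v ('D_w f) y| < e / 2.
have nA : nbhs x A by move: cwv => /cvgrPdist_lt/(_ _ e2).
have nB : nbhs x B by move: cvw => /cvgrPdist_lt/(_ _ e2).
have n1 : nbhs x (U `&` (A `&` B)) .
  by exact: (filterI nU (filterI nA nB)).
have [d /= d0 hd] := (@nbhs_ballP R 'rV[R]_n x _).1 n1.
(* A step size for which all points x + s v + t w stay in the ball. *)
pose M := `|v| + `|w| + 1.
have M0 : 0 < M by rewrite ltr_wpDl // addr_ge0.
pose h := d / 2 / M.
have h0 : 0 < h by rewrite !divr_gt0.
have near_x v' w' s t : `|v'| + `|w'| + 1 = M -> 0 <= s <= h -> 0 <= t <= h ->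
    ball x d (x + s *: v' + t *: w').
  move=> eM /andP[s0 sh] /andP[t0 th].
  rewrite -ball_normE /= !opprD !addrA subrr add0r -opprD normrN.
  apply: (@le_lt_trans _ _ (h * M)); last first.
    by rewrite /h divfK ?gt_eqF // gtr_pMr // invf_lt1 // ltr1n.
  apply: (le_trans (ler_normD _ _)); rewrite !normrZ !ger0_norm //.
  rewrite -eM mulrDr mulrDr mulr1.
  have := ler_wpM2r (normr_ge0 v') sh; have := ler_wpM2r (normr_ge0 w') th; lra.
have dfb y : ball x d y -> differentiable f y by move=> /hd[/df].
have dvb y : ball x d y -> differentiable ('D_v f) y by move=> /hd[/dv].
have dwb y : ball x d y -> differentiable ('D_w f) y by move=> /hd[/dw].
have [s1 [t1 [/andP[s10 s1h] /andP[t10 t1h] E1]]] := second_difference h0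
  (fun s t sh th => (near_x v w s t erefl sh th)) dfb dvb.
have eM' : `|w| + `|v| + 1 = M by rewrite /M (addrC `|w|).
have [s2 [t2 [/andP[s20 s2h] /andP[t20 t2h] E2]]] := second_difference h0
  (fun s t sh th => (near_x w v s t eM' sh th)) dfb dwb.
have b1 : ball x d (x + s1 *: v + t1 *: w) by apply: near_x => //; rewrite !ltW.
have b2 : ball x d (x + s2 *: w + t2 *: v) by apply: near_x => //; rewrite !ltW.
have [_ [A1 _]] := hd _ b1; have [_ [_ B2]] := hd _ b2.
move: A1 B2; rewrite /A /B.
have -> : 'D_w ('D_v f) (x + s1 *: v + t1 *: w) = 'D_v ('D_w f) (x + s2 *: w + t2 *: v).
  have h20 : h ^+ 2 != 0 by rewrite expf_neq0 // gt_eqF.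
  apply: (mulfI h20); refine (etrans (esym E1) (etrans _ E2)).
  rewrite (addrAC x (h *: v)).
  move: (f _) (f (x + _ *: v)) (f (x + _ *: w)) (f x) => a b c d'.
  by rewrite (addrAC a).
exact: dist_le_half.
Qed.

Lemma nbhs_segment (A : set 'rV[R]_n) x v : nbhs x A ->
  exists2 r0 : R, 0 < r0 & forall r, 0 < r <= r0 -> A (x + r *: v).
Proof.
move=> nA; have [d /= d0 hd] := (@nbhs_ballP R 'rV[R]_n x A).1 nA.
have v0 : 0 < `|v| + 1 by rewrite ltr_wpDl.
exists (d / 2 / (`|v| + 1)); first by rewrite !divr_gt0.
move=> r /andP[r0 rd]; apply: hd.
rewrite -ball_normE /= opprD addrA subrr add0r normrN normrZ gtr0_norm //.
apply: (@le_lt_trans _ _ (d / 2)); last by rewrite gtr_pMr // invf_lt1 // ltr1n.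
by move: rd; rewrite ler_pdivlMr // mulrDr mulr1; apply: le_trans; rewrite lerDl ltW.
Qed.

End Lines.

(** * Smooth functions on an open set *)

(** The difference g - f vanishes near x, so it is a little-o of everything and has
differential 0. *)
Lemma near_eq_differentiable (R : realType) (V W : normedModType R)
    (f g : V -> W) (x : V) :
  (\forall y \near x, f y = g y) -> differentiable f x -> differentiable g x.
Proof.
move=> fg df; have fgx : f x = g x by exact: (nbhs_singleton fg).
have d0 : (g - f) \o shift x = cst ((g - f) x) + (0 : V -> W) +o_ 0 id.
  rewrite addr0; apply/eqaddoP => e e0.
  rewrite [\forall y \near _, _ <= _](near_shift x 0).
  apply: filterS fg => y fgy /=.
  rewrite !fctE /= sub0r -addrA subrK -fgy -fgx.
  by rewrite subrr subr0 subrr normr0 mulr_ge0 // ltW.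
have c0 : continuous (0 : V -> W) by move=> y; exact: cvg_cst.
have e0 : 'd (g - f) x = 0 :> (V -> W) by apply/diff_unique.
have -> : g = f + (g - f) by rewrite addrC subrK.
by apply: differentiableD => //; apply/diff_locallyP; rewrite e0.
Qed.

Section PartialRules.
Variables (R : realType) (n : nat).
Implicit Types (x : 'rV[R]_n) (f g : 'rV[R]_n -> R) (U : set 'rV[R]_n) (i : 'I_n).

Lemma partial_ext U f g i x : open U -> U x -> (forall y, U y -> f y = g y) ->
  partial i f x = partial i g x.
Proof.
move=> oU Ux fg; apply: near_eq_derive.
by apply: filterS (open_nbhs_nbhs (conj oU Ux)).
Qed.

Lemma differentiable_ext U f g x : open U -> U x ->
  (forall y, U y -> f y = g y) -> differentiable f x -> differentiable g x.
Proof.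
move=> oU Ux fg; apply: near_eq_differentiable.
by apply: filterS (open_nbhs_nbhs (conj oU Ux)).
Qed.

Lemma partial_cst i x (a : R) : partial i (fun=> a) x = 0.
Proof. exact: derive_cst. Qed.

Lemma partialD i f g x : differentiable f x -> differentiable g x ->
  partial i (fun y => f y + g y) x = partial i f x + partial i g x.
Proof. by move=> df dg; apply: deriveD; apply: diff_derivable. Qed.

Lemma partialN i f x : differentiable f x ->
  partial i (fun y => - f y) x = - partial i f x.
Proof. by move=> df; apply: deriveN; apply: diff_derivable. Qed.

Lemma partialB i f g x : differentiable f x -> differentiable g x ->
  partial i (fun y => f y - g y) x = partial i f x - partial i g x.
Proof. by move=> df dg; apply: deriveB; apply: diff_derivable. Qed.

Lemma partialM i f g x : differentiable f x -> differentiable g x ->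
  partial i (fun y => f y * g y) x = f x * partial i g x + g x * partial i f x.
Proof. by move=> df dg; apply: deriveM; apply: diff_derivable. Qed.

Lemma partial_coord i k x : partial i (fun y : 'rV[R]_n => y 0 k) x = (k == i)%:R.
Proof.
rewrite /partial deriveE; last exact: differentiable_coord.
have @f : {linear 'rV[R]_n -> R}.
  by exists (fun N : 'rV[R]_n => N 0 k); do 2![eexists]; do ?[constructor];
     rewrite ?mxE// => ? *; rewrite ?mxE//; move=> ?; rewrite !mxE.
rewrite (_ : (fun _ => _) = f) // diff_lin ?mxE //=.
  by rewrite mxE eqxx.
exact: coord_continuous.
Qed.

Lemma differentiable_powR f x (a : R) : differentiable f x -> 0 < f x ->
  differentiable (fun y => f y `^ a) x.
Proof.
move=> df f0; have dp := is_derive1_powR a f0.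
have dpf : differentiable (fun z : R => z `^ a) (f x) by apply/derivable1_diffP; case: dp.
exact: (@differentiable_comp _ _ _ _ f (fun z : R => z `^ a)).
Qed.

Lemma partial_powR i f x (a : R) : differentiable f x -> 0 < f x ->
  partial i (fun y => f y `^ a) x = a * f x `^ (a - 1) * partial i f x.
Proof.
move=> df f0; have dp := is_derive1_powR a f0.
have dpf : differentiable (fun z : R => z `^ a) (f x) by apply/derivable1_diffP; case: dp.
rewrite /partial !deriveE //; last exact: differentiable_powR.
rewrite (_ : (fun _ => _) = (fun z : R => z `^ a) \o f) // diff_comp //=.
rewrite -[X in 'd _ _ X]mulr1 -[_ * 1]/(_ *: 1) linearZ /=.
have <- : 'D_1 (fun z : R => z `^ a) (f x) = 'd (fun z : R => z `^ a) (f x) 1.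
  by rewrite deriveE.
rewrite (@derive_val _ _ _ _ _ _ _ dp).
exact: mulrC.
Qed.

End PartialRules.

Section Smooth.
Variables (R : realType) (n : nat).
Implicit Types (x : 'rV[R]_n) (f g : 'rV[R]_n -> R) (U : set 'rV[R]_n) (i : 'I_n).

(** [smooth_on] applies its derivatives to the outside of a composite; peeling off the
innermost derivative, with a bound on the order, is what makes the closure
properties provable by induction. *)
Fixpoint smooth_upto (m : nat) U f : Prop :=
  (forall x, U x -> differentiable f x) /\
  if m is m'.+1 then forall i, smooth_upto m' U (partial i f) else True.

Lemma smooth_onP U f : smooth_on U f <-> forall m, smooth_upto m U f.
Proof.
split=> [sf m|].
  elim: m f sf => [|m IH] f sf /=.
    by split => // x; exact: (sf [::]).
  split; first by move=> x; exact: (sf [::]).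
  move=> i; apply: IH => s x Ux.
  have := sf (rcons s i) x Ux.
  by rewrite -cats1 foldr_cat.
move=> h s; elim/last_ind: s f h => [|s i IH] f h x Ux.
  exact: (h 0).1.
rewrite -cats1 foldr_cat /=; apply: (IH (partial i f)) => // m.
exact: (h m.+1).2.
Qed.

Lemma smooth_on_differentiable U f x : smooth_on U f -> U x -> differentiable f x.
Proof. by move=> sf; exact: (sf [::]). Qed.

Lemma smooth_on_partial U f i : smooth_on U f -> smooth_on U (partial i f).
Proof.
by move=> /smooth_onP sf; apply/smooth_onP => m; exact: (sf m.+1).2.
Qed.

Variables (U : set 'rV[R]_n) (oU : open U).

Lemma smooth_upto_ext m f g : (forall y, U y -> f y = g y) ->
  smooth_upto m U f -> smooth_upto m U g.
Proof.
elim: m f g => [|m IH] f g fg /= [df sf]; split => //.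
- by move=> x Ux; apply: differentiable_ext fg (df x Ux).
- by move=> x Ux; apply: differentiable_ext fg (df x Ux).
- by move=> i; apply: IH (sf i) => y Uy; apply: partial_ext fg.
Qed.

Lemma smooth_upto_pred m f : smooth_upto m.+1 U f -> smooth_upto m U f.
Proof.
elim: m f => [|m IH] f [df sf]; first by split.
by split => // i; apply: IH.
Qed.

Lemma smooth_upto_diff m f x : smooth_upto m U f -> U x -> differentiable f x.
Proof. by case: m => [|m] [df _] Ux; apply: df. Qed.

Lemma smooth_upto_cst m (a : R) : smooth_upto m U (fun=> a).
Proof.
elim: m a => [|m IH] a; split => //; try by move=> x _; exact: differentiable_cst.
by move=> i; apply: smooth_upto_ext (IH 0) => y _; rewrite partial_cst.
Qed.

Lemma smooth_upto_coord m (k : 'I_n) : smooth_upto m U (fun x => x 0 k).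
Proof.
case: m => [|m]; split => //; try by move=> x _; exact: differentiable_coord.
move=> i; apply: smooth_upto_ext (smooth_upto_cst m (k == i)%:R) => y _.
by rewrite partial_coord.
Qed.

Lemma smooth_uptoD m f g : smooth_upto m U f -> smooth_upto m U g ->
  smooth_upto m U (fun x => f x + g x).
Proof.
elim: m f g => [|m IH] f g sf sg.
  by split => // x Ux; apply: differentiableD; apply: smooth_upto_diff Ux; eassumption.
have d h x : smooth_upto m.+1 U h -> U x -> differentiable h x by exact: smooth_upto_diff.
split; first by move=> x Ux; apply: differentiableD; apply: d.
move=> i; apply: smooth_upto_ext (IH _ _ (sf.2 i) (sg.2 i)) => y Uy.
by rewrite partialD //; exact: d.
Qed.

Lemma smooth_uptoM m f g : smooth_upto m U f -> smooth_upto m U g ->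
  smooth_upto m U (fun x => f x * g x).
Proof.
elim: m f g => [|m IH] f g sf sg.
  by split => // x Ux; apply: differentiableM; apply: smooth_upto_diff Ux; eassumption.
have d h x : smooth_upto m.+1 U h -> U x -> differentiable h x by exact: smooth_upto_diff.
split; first by move=> x Ux; apply: differentiableM; apply: d.
move=> i; have h1 := IH _ _ (smooth_upto_pred sf) (sg.2 i).
have h2 := IH _ _ (smooth_upto_pred sg) (sf.2 i).
apply: smooth_upto_ext (smooth_uptoD h1 h2) => y Uy.
by rewrite partialM //; exact: d.
Qed.

(** All exponents have to be treated at once, because differentiation lowers the
exponent by one. *)
Lemma smooth_upto_powR m f (a : R) : (forall x, U x -> 0 < f x) ->
  smooth_upto m U f -> smooth_upto m U (fun x => f x `^ a).
Proof.
move=> f0; elim: m a => [|m IH] a sf.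
  by split => // x Ux; apply: differentiable_powR (f0 _ Ux); apply: smooth_upto_diff Ux; eassumption.
have d x : U x -> differentiable f x by exact: smooth_upto_diff sf.
split; first by move=> x Ux; exact: differentiable_powR (d _ Ux) (f0 _ Ux).
move=> i.
have h := smooth_uptoM (smooth_uptoM (smooth_upto_cst m a)
  (IH (a - 1) (smooth_upto_pred sf))) (sf.2 i).
apply: smooth_upto_ext h => y Uy.
by rewrite partial_powR //; [exact: d | exact: f0].
Qed.

Lemma smooth_on_ext f g : (forall y, U y -> f y = g y) ->
  smooth_on U f -> smooth_on U g.
Proof.
by move=> fg /smooth_onP sf; apply/smooth_onP => m; exact: smooth_upto_ext fg (sf m).
Qed.

Lemma smooth_on_cst (a : R) : smooth_on U (fun=> a).
Proof. by apply/smooth_onP => m; exact: smooth_upto_cst. Qed.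

Lemma smooth_on_coord (k : 'I_n) : smooth_on U (fun x => x 0 k).
Proof. by apply/smooth_onP => m; exact: smooth_upto_coord. Qed.

Lemma smooth_onD f g : smooth_on U f -> smooth_on U g ->
  smooth_on U (fun x => f x + g x).
Proof.
by move=> /smooth_onP sf /smooth_onP sg; apply/smooth_onP => m; exact: smooth_uptoD.
Qed.

Lemma smooth_onM f g : smooth_on U f -> smooth_on U g ->
  smooth_on U (fun x => f x * g x).
Proof.
by move=> /smooth_onP sf /smooth_onP sg; apply/smooth_onP => m; exact: smooth_uptoM.
Qed.

Lemma smooth_onN f : smooth_on U f -> smooth_on U (fun x => - f x).
Proof.
move=> sf; apply: smooth_on_ext (smooth_onM (smooth_on_cst (-1)) sf) => y _.
by rewrite mulN1r.
Qed.

Lemma smooth_onB f g : smooth_on U f -> smooth_on U g ->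
  smooth_on U (fun x => f x - g x).
Proof. by move=> sf sg; apply: smooth_onD => //; exact: smooth_onN. Qed.

Lemma smooth_on_powR f (a : R) : (forall x, U x -> 0 < f x) ->
  smooth_on U f -> smooth_on U (fun x => f x `^ a).
Proof.
by move=> f0 /smooth_onP sf; apply/smooth_onP => m; exact: smooth_upto_powR.
Qed.

Lemma smooth_onV f : (forall x, U x -> 0 < f x) ->
  smooth_on U f -> smooth_on U (fun x => (f x)^-1).
Proof.
move=> f0 sf; apply: smooth_on_ext (smooth_on_powR (-1) f0 sf) => y Uy.
by rewrite powR_inv1 // ltW // f0.
Qed.

Lemma smooth_on_sum (I : finType) (F : I -> 'rV[R]_n -> R) :
  (forall k, smooth_on U (F k)) -> smooth_on U (fun x => \sum_k F k x).
Proof.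
move=> sF.
suff h (s : seq I) : smooth_on U (fun x => \sum_(k <- s) F k x) by exact: h.
elim: s => [|k s IH].
  by apply: smooth_on_ext (smooth_on_cst 0) => y _; rewrite big_nil.
by apply: smooth_on_ext (smooth_onD (sF k) IH) => y _; rewrite big_cons.
Qed.

Lemma partial_comm f i j x : U x -> smooth_on U f ->
  partial i (partial j f) x = partial j (partial i f) x.
Proof.
move=> Ux sf; have d g y : smooth_on U g -> U y -> differentiable g y.
  exact: smooth_on_differentiable.
have dp k y : U y -> differentiable (partial k f) y by apply: d; exact: smooth_on_partial.
have cpp k l : {for x, continuous (partial k (partial l f))}.
  by apply/differentiable_continuous/d => //; do 2!apply: smooth_on_partial.
apply: (derive_comm oU Ux _ (dp j) (dp i) (cpp i j) (cpp j i)) => y.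
exact: d.
Qed.

End Smooth.

(** * Ricci tensor of a conformally flat metric *)

Section DeltaSums.
Variables (R : comNzRingType) (I : finType).

Lemma sum_delta (i : I) (F : I -> R) : \sum_l (l == i)%:R * F l = F i.
Proof.
rewrite (bigD1 i) //= eqxx mul1r big1 ?addr0 // => l li.
by rewrite (negbTE li) mul0r.
Qed.

End DeltaSums.

Section ConformalGamma.
Variables (R : comNzRingType) (n : nat) (a : 'I_n -> R).

(** For b the differential of phi these are the Christoffel symbols of the metric
exp (2 phi) times the Euclidean one. *)
Definition gamma (b : 'I_n -> R) (k i j : 'I_n) : R :=
  (k == i)%:R * b j + (k == j)%:R * b i - (i == j)%:R * b k.

Lemma sum_gamma (X : 'I_n -> R) i j :
  \sum_m X m * gamma a m i j =
  X i * a j + X j * a i - (i == j)%:R * \sum_m X m * a m.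
Proof.
transitivity (\sum_m ((m == i)%:R * (X m * a j) + (m == j)%:R * (X m * a i)
   - (i == j)%:R * (X m * a m))).
  by apply: eq_bigr => m _; rewrite /gamma; ring.
by rewrite sumrB big_split /= !sum_delta -mulr_sumr.
Qed.

Lemma gamma_diag b l m : gamma b l l m = b m :> R.
Proof. by rewrite /gamma eqxx mul1r addrK. Qed.

(** The contraction that gives the Ricci tensor, with A in the role of the
derivatives of a. Every sum reduces to [sum_delta] and [sum_gamma]. *)
Lemma ricci_algebra (A : 'I_n -> 'I_n -> R) i j :
  A i j = A j i ->
  \sum_l (gamma (A l) l i j - gamma (A i) l l j +
     \sum_m (gamma a l l m * gamma a m i j - gamma a l i m * gamma a m l j))
  = (2 - n%:R) * (A i j - a i * a j)
    - (i == j)%:R * (\sum_l A l l + (n%:R - 2) * \sum_l a l * a l).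
Proof.
move=> Asym; set N := \sum_l a l * a l.
transitivity (\sum_l ((l == i)%:R * A l j + (l == j)%:R * A l i - (i == j)%:R * A l l
   - A i j + (2 * a i * a j - (i == j)%:R * N)
   - ((l == i)%:R * (2 * a l * a j - (l == j)%:R * N) + a i * a j
      - ((l == i)%:R * (a l * a j) + (i == j)%:R * (a l * a l)
         - (l == j)%:R * (a l * a i))))).
  apply: eq_bigr => l _; rewrite gamma_diag sumrB.
  under eq_bigr do rewrite gamma_diag.
  rewrite sum_gamma -/N.
  have -> : \sum_m gamma a l i m * gamma a m l j =
     (l == i)%:R * (\sum_m a m * gamma a m l j)
     + a i * \sum_m (m == l)%:R * gamma a m l j
     - a l * \sum_m (m == i)%:R * gamma a m l j.
    rewrite !mulr_sumr -big_split -sumrB /=; apply: eq_bigr => m _.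
    by rewrite {1}/gamma (eq_sym l m) (eq_sym i m); ring.
  rewrite sum_gamma !sum_delta -/N gamma_diag /gamma (eq_sym i l).
  ring.
do 4!rewrite ?sumrB ?big_split /=.
rewrite !sumrN !sum_delta -!mulr_sumr -/N !sumr_const card_ord -Asym.
rewrite -(mulr_natr (a j)) -(mulr_natr (A i j)) -(mulr_natr N).
ring.
Qed.

End ConformalGamma.

Section ConformallyFlat.
Variables (R : realType) (n : nat) (U : set 'rV[R]_n) (oU : open U).
Variables (f : 'rV[R]_n -> R) (f_smooth : smooth_on U f).
Hypothesis f_gt0 : forall x, U x -> 0 < f x.
Variable (h : 'rV[R]_n -> 'M[R]_n).
Hypothesis hE : forall x, U x -> h x = (f x)^-1%:M.

(* The metric is h = exp (2 phi) times the Euclidean one with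
   phi = - (log f) / 2, and a is the differential of phi. By [ricci_conformal] below,
   Ric = (2 - n) S - E times the Kronecker symbol. *)
Let g x := (f x)^-1.
Let a i x := - (2^-1 * (partial i f x * g x)).
Let S i j x := partial i (a j) x - a i x * a j x.
Let E x := \sum_l partial l (a l) x + (n%:R - 2) * \sum_l a l x * a l x.

Let g_smooth : smooth_on U g.
Proof. exact: smooth_onV. Qed.

Let d k x : smooth_on U k -> U x -> differentiable k x.
Proof. exact: smooth_on_differentiable. Qed.

Let f1_smooth i : smooth_on U (partial i f).
Proof. exact: smooth_on_partial. Qed.

Let f2_smooth i j : smooth_on U (partial i (partial j f)).
Proof. exact: smooth_on_partial. Qed.

Let a_smooth i : smooth_on U (a i).
Proof.
apply: smooth_onN => //; apply: smooth_onM => //; first exact: smooth_on_cst.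
exact: smooth_onM.
Qed.

Let S_smooth i j : smooth_on U (S i j).
Proof.
apply: smooth_onB => //; first exact: smooth_on_partial.
exact: smooth_onM.
Qed.

Let E_smooth : smooth_on U E.
Proof.
apply: smooth_onD => //.
  by apply: smooth_on_sum => // l; exact: smooth_on_partial.
apply: smooth_onM => //; first exact: smooth_on_cst.
by apply: smooth_on_sum => // l; exact: smooth_onM.
Qed.

Let partial_g i x : U x -> partial i g x = - (partial i f x * g x ^+ 2).
Proof.
move=> Ux; rewrite /partial deriveV ?gt_eqF ?f_gt0 //; last first.
  by apply: diff_derivable; exact: d.
by rewrite -[LHS]/(- (f x ^- 2) * _) mulNr mulrC -exprVn.
Qed.

Lemma christoffel_conformal k i j x : U x ->
  christoffel h k i j x = gamma (a^~ x) k i j.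
Proof.
move=> Ux.
have ph m p q : partial m (fun y => h y p q) x = (p == q)%:R * partial m g x.
  rewrite (@partial_ext _ _ U _ (fun y => (p == q)%:R * g y)) //; last first.
    by move=> y Uy; rewrite hE // mxE mulr_natl.
  rewrite partialM ?partial_cst ?mulr0 ?addr0 //; exact: d.
rewrite /christoffel.
transitivity (2^-1 * \sum_l (l == k)%:R * (f x * ((j == l)%:R * partial i g x
    + (i == l)%:R * partial j g x - (i == j)%:R * partial l g x))).
  congr (_ * _); apply: eq_bigr => l _.
  by rewrite !ph hE // invmx_scalar mxE invrK (eq_sym k l) -[f x *+ _]mulr_natl -mulrA.
rewrite sum_delta !partial_g // /gamma /a (eq_sym j k) (eq_sym i k).
have fx : f x != 0 by rewrite gt_eqF ?f_gt0.
rewrite /g; move: (partial i f x) (partial j f x) (partial k f x) (f x) fx.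
by move=> fi fj fk y y0; field.
Qed.

Lemma partial_gamma m k i j x : U x ->
  partial m (fun y => gamma (a^~ y) k i j) x = gamma (fun l => partial m (a l) x) k i j.
Proof.
move=> Ux; rewrite /gamma.
have s1 p l : smooth_on U (fun y => (p : R) * a l y).
  by apply: smooth_onM => //; exact: smooth_on_cst.
have p1 p l : partial m (fun y => (p : R) * a l y) x = p * partial m (a l) x.
  by rewrite partialM ?partial_cst ?mulr0 ?addr0 //; exact: d.
have ds p l : differentiable (fun y => (p : R) * a l y) x := d (s1 p l) Ux.
rewrite partialB; [|exact: d (smooth_onD oU (s1 _ _) (s1 _ _)) Ux|exact: ds].
rewrite partialD; [|exact: ds|exact: ds].
by rewrite !p1.
Qed.

Lemma partial_a i j x : U x -> partial i (a j) x =
  - (2^-1 * (partial i (partial j f) x * g x - partial i f x * partial j f x * g x ^+ 2)).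
Proof.
move=> Ux; have sfg := smooth_onM oU (f1_smooth j) g_smooth.
have sc c := smooth_on_cst oU c.
rewrite /a partialN; last first.
  by apply: d => //; apply: smooth_onM => //; exact: smooth_on_cst.
rewrite partialM ?partial_cst ?mulr0 ?addr0; [|exact: d|exact: d].
rewrite partialM; [|exact: d|exact: d].
rewrite partial_g //.
move: (partial i _ x) (partial i f x) (partial j f x) (g x) => fij fi fj y.
ring.
Qed.

Lemma ricci_conformal i j x : U x ->
  ricci h x i j = (2 - n%:R) * S i j x - (i == j)%:R * E x.
Proof.
move=> Ux; rewrite mxE.
have pc m k p q : partial m (christoffel h k p q) x =
    gamma (fun l => partial m (a l) x) k p q.
  rewrite -partial_gamma //; apply: partial_ext oU Ux _ => y Uy.
  exact: christoffel_conformal.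
pose A m l := partial m (a l) x; pose b l := a l x.
have Asym : A i j = A j i.
  rewrite /A (partial_a i j Ux) (partial_a j i Ux) (partial_comm oU i j Ux f_smooth).
  move: (partial j (partial i f) x) (partial i f x) (partial j f x) (g x).
  by move=> fij fi fj y; ring.
transitivity (\sum_l (gamma (A l) l i j - gamma (A i) l l j +
     \sum_m (gamma b l l m * gamma b m i j - gamma b l i m * gamma b m l j))).
  apply: eq_bigr => l _; rewrite /riemann !pc; congr (_ + _).
  by apply: eq_bigr => m _; rewrite !christoffel_conformal.
exact: ricci_algebra.
Qed.

Lemma S_sym i j x : U x -> S i j x = S j i x.
Proof.
move=> Ux; rewrite /S (partial_a i j Ux) (partial_a j i Ux).
rewrite (partial_comm oU i j Ux f_smooth).
move: (partial j (partial i f) x) (partial i f x) (partial j f x) (g x) (a i x) (a j x).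
by move=> fij fi fj y ai aj; ring.
Qed.

Lemma SE i j x : U x -> S i j x =
  4^-1 * (partial i f x * partial j f x * g x ^+ 2) - 2^-1 * (partial i (partial j f) x * g x).
Proof.
move=> Ux; rewrite /S (partial_a i j Ux) /a.
move: (partial i _ x) (partial i f x) (partial j f x) (g x) => fij fi fj y.
by field.
Qed.

(** Up to the correction terms which [gamma] produces from its third summand, the left
side is the covariant derivative of S. All terms of lower order in f cancel: this
is the reason for using the reciprocal of the conformal factor as the unknown. *)
Lemma partial_S m i j x : U x ->
  partial m (S i j) x - S m j x * a i x - S m i x * a j x - 2 * (S i j x * a m x)
  = - (2^-1 * (partial m (partial i (partial j f)) x * g x)).
Proof.
move=> Ux.
pose T y := 4^-1 * (partial i f y * partial j f y * (g y * g y))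
   - 2^-1 * (partial i (partial j f) y * g y).
have -> : partial m (S i j) x = partial m T x.
  by apply: partial_ext oU Ux _ => y Uy; rewrite SE // expr2.
have s1 := smooth_onM oU (f1_smooth i) (f1_smooth j).
have s2 := smooth_onM oU g_smooth g_smooth.
have s3 := smooth_onM oU s1 s2.
have s4 := smooth_onM oU (f2_smooth i j) g_smooth.
have sc c := smooth_on_cst oU c.
rewrite /T partialB; [|by apply: d => //; exact: smooth_onM..].
do !(rewrite partialM; [|exact: d|exact: d]).
rewrite !partial_cst (partial_g _ Ux) (SE m j Ux) (SE m i Ux) (SE i j Ux) /a.
move: (partial m (partial i (partial j f)) x) (partial i (partial j f) x)
  (partial m (partial i f) x) (partial m (partial j f) x)
  (partial m f x) (partial i f x) (partial j f x) (g x) => fmij fij fmi fmj fm fi fj y.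
by field.
Qed.

Lemma covariant_ricci_conformal m i j x : U x ->
  covariant_derivative h (ricci h) m i j x =
  (n%:R - 2) * (2^-1 * (partial m (partial i (partial j f)) x * g x)
     - (m == i)%:R * (\sum_l S l j x * a l x) - (m == j)%:R * (\sum_l S l i x * a l x))
  - (i == j)%:R * (partial m E x - 2 * (E x * a m x)).
Proof.
move=> Ux; pose B q := \sum_l S l q x * a l x.
rewrite /covariant_derivative -/(B i) -/(B j).
have sc c := smooth_on_cst oU c.
pose T p q := (2 - n%:R) * S p q x - (p == q)%:R * E x.
have -> : partial m (fun y => ricci h y i j) x =
    (2 - n%:R) * partial m (S i j) x - (i == j)%:R * partial m E x.
  rewrite (@partial_ext _ _ U _
    (fun y => (2 - n%:R) * S i j y - (i == j)%:R * E y)) //; last first.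
    by move=> y Uy; rewrite ricci_conformal.
  rewrite partialB; [|by apply: d => //; exact: smooth_onM..].
  by do !(rewrite partialM; [|exact: d|exact: d]); rewrite !partial_cst !mulr0 !addr0.
have sumT p q : \sum_l christoffel h l m p x * T l q =
    T m q * a p x + T p q * a m x - (m == p)%:R *
      ((2 - n%:R) * B q - E x * a q x).
  transitivity (\sum_l T l q * gamma (a^~ x) l m p).
    by apply: eq_bigr => l _; rewrite christoffel_conformal // mulrC.
  rewrite sum_gamma; congr (_ - _ * _).
  transitivity (\sum_l ((2 - n%:R) * (S l q x * a l x) - (l == q)%:R * (E x * a l x))).
    by apply: eq_bigr => l _; rewrite /T mulrBl !mulrA.
  by rewrite sumrB -mulr_sumr sum_delta.
have -> : \sum_l (christoffel h l m i x * ricci h x l j +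
    christoffel h l m j x * ricci h x i l) =
  \sum_l christoffel h l m i x * T l j + \sum_l christoffel h l m j x * T l i.
  rewrite -big_split; apply: eq_bigr => l _ /=.
  by rewrite !ricci_conformal // (S_sym i l Ux) (eq_sym i l).
rewrite !sumT /T.
have := partial_S m i j Ux.
rewrite (S_sym m i Ux) (S_sym j i Ux) (eq_sym j i).
move: (partial m (partial _ _) x) (partial m E x) => fmij Em.
move: (B i) (B j) => bi bj.
move: (partial m _ x) (S i j x) (S i m x) (S m j x) => pS Sij Smi Smj.
move: (a i x) (a j x) (a m x) (E x) (g x) => ai aj am e y H.
have -> : 2^-1 * (fmij * y) = - (pS - Smj * ai - Smi * aj - 2 * (Sij * am)).
  by rewrite H opprK.
by ring.
Qed.

(** The trace part E of the Ricci tensor only contributes multiples of the Kronecker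
symbol (i == j), so its derivatives enter through a single unknown covector e. The
other unknown b comes from the correction terms; comparing the derivatives of
orders (m, i, i) and (i, i, m) for i distinct from m shows that e = b. *)
Lemma parallel_third_derivatives : (3 <= n)%N ->
  (forall x, U x -> forall m i j, covariant_derivative h (ricci h) m i j x = 0) ->
  let t j x := partial j (partial j (partial j f)) x / 3 in
  forall x, U x -> forall m i j, partial m (partial i (partial j f)) x =
    (m == i)%:R * t j x + (m == j)%:R * t i x + (i == j)%:R * t m x.
Proof.
move=> n3 par t x Ux.
pose B q := \sum_l S l q x * a l x.
pose b j := 2 * f x * B j.
pose e m := 2 * f x / (n%:R - 2) * (partial m E x - 2 * (E x * a m x)).
have fx : f x != 0 by rewrite gt_eqF ?f_gt0.
have n2 : n%:R - 2 != 0 :> R.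
  by rewrite subr_eq0 -[2]/(2%:R) eqr_nat gtn_eqF.
have eq1 m i j : partial m (partial i (partial j f)) x =
    (m == i)%:R * b j + (m == j)%:R * b i + (i == j)%:R * e m.
  have /eqP : (n%:R - 2) * (2^-1 * (partial m (partial i (partial j f)) x * g x)
      - (m == i)%:R * B j - (m == j)%:R * B i)
      - (i == j)%:R * (partial m E x - 2 * (E x * a m x)) = 0.
    exact: etrans (esym (covariant_ricci_conformal m i j Ux)) (par x Ux m i j).
  rewrite /b /e /g.
  move: (partial m (partial i (partial j f)) x) (B i) (B j) => fmij bi bj.
  move: (partial m E x - 2 * (E x * a m x)) => Em.
  rewrite subr_eq0 => /eqP H.
  have -> : fmij = 2 * f x / (n%:R - 2) * ((n%:R - 2) * (2^-1 * (fmij / f x))).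
    by field; rewrite n2 fx.
  have -> : (n%:R - 2) * (2^-1 * (fmij / f x)) = (n%:R - 2) * (2^-1 * (fmij / f x)
     - (m == i)%:R * bj - (m == j)%:R * bi) + (n%:R - 2) * ((m == i)%:R * bj + (m == j)%:R * bi).
    by ring.
  by rewrite H; field; rewrite n2.
have eb m : e m = b m.
  have [i im] : exists i : 'I_n, i != m.
    have [m0|m0] := eqVneq (m : nat) 0%N.
      by exists (Ordinal (ltnW n3)); rewrite -val_eqE /= m0.
    by exists (Ordinal (ltnW (ltnW n3))); rewrite -val_eqE /= eq_sym.
  have := eq1 m i i; have := eq1 i i m.
  rewrite (eq_sym m i) (negbTE im) eqxx !mul0r !add0r !addr0 !mul1r => <- <-.
  rewrite -(partial_comm oU i m Ux (f1_smooth i)).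
  by apply: partial_ext oU Ux _ => y Uy; rewrite (partial_comm oU i m Uy f_smooth).
have tb k : t k x = b k.
  by have := eq1 k k k; rewrite eqxx eb !mul1r /t => ->; field.
by move=> m i j; rewrite eq1 !tb eb.
Qed.

End ConformallyFlat.

(** * Integration of the third-order equation *)

Lemma exists_notin (R : realType) (s : seq R) : exists r, r \notin s.
Proof.
(* This number exceeds every element of s. *)
exists (1 + \sum_(y <- s) `|y|); apply/negP => h.
suff : 1 + \sum_(y <- s) `|y| <= \sum_(y <- s) `|y|.
  by rewrite gerDr leNgt ltr01.
apply: (le_trans (ler_norm _)); rewrite [leRHS](big_rem _ h) /= lerDl.
by apply: sumr_ge0.
Qed.

Section Connectedness.
Variables (R : realType) (n : nat).
Implicit Types (x y z v : 'rV[R]_n).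

Lemma derive_partials (f : 'rV[R]_n -> R) x v : differentiable f x ->
  'D_v f x = \sum_i v 0 i * partial i f x.
Proof.
move=> df; rewrite deriveE // {1}(row_sum_delta v) linear_sum /=.
by apply: eq_bigr => i _; rewrite linearZ /= /partial deriveE.
Qed.

(** Take z = (x + y) / 2 + r e_j with e_j not parallel to y - x. A point of s different
from x lies on the line through x and z for at most one value of r, and likewise
for y; so all but finitely many r are suitable. *)
Lemma two_leg_path (s : seq 'rV[R]_n) x y : (2 <= n)%N ->
  x \notin s -> y \notin s -> x != y ->
  exists z, forall t, x + t *: (z - x) \notin s /\ y + t *: (z - y) \notin s.
Proof.
move=> n2 xs ys xy.
have [i Di] : exists i, y 0 i - x 0 i != 0.
  apply/existsP; rewrite -[X in is_true X]negbK negb_exists; apply/negP => /forallP h.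
  move/eqP: xy; apply; apply/rowP => i; apply/esym/eqP.
  by rewrite -subr_eq0 -[_ == _]negbK.
have [j ji] : exists j : 'I_n, j != i.
  have [i0|i0] := eqVneq (i : nat) 0%N.
    by exists (Ordinal n2); rewrite -val_eqE /= i0.
  by exists (Ordinal (ltnW n2)); rewrite -val_eqE /= eq_sym.
set D := y - x; have DE k : D 0 k = y 0 k - x 0 k by rewrite !mxE.
(* The only value of r for which the line through x and z (resp. y and z)
   can meet a, read off from the coordinates i and j. *)
pose c1 (a : 'rV[R]_n) := (a 0 j - x 0 j) * D 0 i / (2 * (a 0 i - x 0 i)) - D 0 j / 2.
pose c2 (a : 'rV[R]_n) := - ((a 0 j - y 0 j) * D 0 i / (2 * (a 0 i - y 0 i))) + D 0 j / 2.
have [r] := exists_notin (map c1 s ++ map c2 s).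
rewrite mem_cat negb_or => /andP[r1 r2].
pose z := x + (2^-1 *: D + r *: delta_mx 0 j).
have zi : z 0 i = x 0 i + D 0 i / 2.
  by rewrite /z !mxE eqxx /= eq_sym (negbTE ji) mulr0 addr0 mulrC.
have zj : z 0 j = x 0 j + D 0 j / 2 + r.
  by rewrite /z !mxE !eqxx /= mulr1 addrA [_^-1 * _]mulrC.
exists z => t; split; apply/negP => ts.
- have t0 : t != 0.
    by apply: contraNneq xs => t0; move: ts; rewrite t0 scale0r addr0.
  move/negP: r1; apply; apply/mapP; exists (x + t *: (z - x)) => //.
  have := zi; have := zj; rewrite /c1 !mxE => -> ->.
  have := Di; rewrite ?DE; move: (x 0 i) (x 0 j) (y 0 i) (y 0 j) => a b c e H.
  field; rewrite [X in X != 0](_ : _ = t * (c - a)); last by ring.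
  exact: mulf_neq0.
- have t0 : t != 0.
    by apply: contraNneq ys => t0; move: ts; rewrite t0 scale0r addr0.
  move/negP: r2; apply; apply/mapP; exists (y + t *: (z - y)) => //.
  have := zi; have := zj; rewrite /c2 !mxE => -> ->.
  have := Di; rewrite ?DE; move: (x 0 i) (x 0 j) (y 0 i) (y 0 j) => a b c e H.
  field; rewrite [X in X != 0](_ : _ = - t * (c - a)); last by ring.
  by rewrite mulf_neq0 // oppr_eq0.
Qed.

Lemma zero_partials_cst (U : set 'rV[R]_n) (s : seq 'rV[R]_n) (f : 'rV[R]_n -> R) :
  (2 <= n)%N -> (forall x, U x <-> x \notin s) ->
  (forall x, U x -> differentiable f x) ->
  (forall x i, U x -> partial i f x = 0) ->
  forall x y, U x -> U y -> f y = f x.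
Proof.
move=> n2 Us df pf x y Ux Uy.
have leg u z : (forall t, U (u + t *: (z - u))) -> f z = f u.
  move=> h; have [t _] := @line_MVT R n f u (z - u) 1 ltr01 (fun t _ => df _ (h t)).
  rewrite scale1r (addrC u) subrK derive_partials; last exact: df.
  rewrite big1 ?mulr0 => [/subr0_eq //|i _].
  by rewrite pf ?mulr0.
have [->//|xy] := eqVneq x y.
have [z hz] := two_leg_path n2 ((Us x).1 Ux) ((Us y).1 Uy) xy.
by rewrite -(leg x z) -?(leg y z) // => t; apply/Us; have [] := hz t.
Qed.

End Connectedness.

Section HasPartial.
Variables (R : realType) (n : nat) (i : 'I_n) (x : 'rV[R]_n).
Implicit Types (f g : 'rV[R]_n -> R) (a b : R).

(** Bundling differentiability with the value of the derivative lets the derivative of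
an explicit polynomial be assembled by composing lemmas. *)
Definition has_partial f a := differentiable f x /\ partial i f x = a.

Lemma has_partial_cst a : has_partial (fun=> a) 0.
Proof. by split; [exact: differentiable_cst | exact: partial_cst]. Qed.

Lemma has_partial_coord k : has_partial (fun y => y 0 k) (k == i)%:R.
Proof. by split; [exact: differentiable_coord | exact: partial_coord]. Qed.

Lemma has_partialD f g a b : has_partial f a -> has_partial g b ->
  has_partial (fun y => f y + g y) (a + b).
Proof.
by move=> [df <-] [dg <-]; split; [exact: differentiableD | exact: partialD].
Qed.

Lemma has_partialB f g a b : has_partial f a -> has_partial g b ->
  has_partial (fun y => f y - g y) (a - b).
Proof.
by move=> [df <-] [dg <-]; split; [exact: differentiableB | exact: partialB].
Qed.

Lemma has_partialM f g a b : has_partial f a -> has_partial g b ->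
  has_partial (fun y => f y * g y) (f x * b + g x * a).
Proof.
by move=> [df <-] [dg <-]; split; [exact: differentiableM | exact: partialM].
Qed.

Lemma has_partialZ f a b : has_partial f b -> has_partial (fun y => a * f y) (a * b).
Proof.
move=> h; have := has_partialM (has_partial_cst a) h.
by rewrite mulr0 addr0.
Qed.

Lemma has_partial_sum (I : finType) (F : I -> 'rV[R]_n -> R) (a : I -> R) :
  (forall k, has_partial (F k) (a k)) ->
  has_partial (fun y => \sum_k F k y) (\sum_k a k).
Proof.
move=> hF.
suff h (s : seq I) : has_partial (fun y => \sum_(k <- s) F k y) (\sum_(k <- s) a k).
  exact: h.
elim: s => [|k s IH].
  rewrite big_nil (_ : (fun _ => _) = fun=> 0); first exact: has_partial_cst.
  by apply/funext => y; rewrite big_nil.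
rewrite big_cons (_ : (fun _ => _) = fun y => F k y + \sum_(l <- s) F l y).
  exact: has_partialD.
by apply/funext => y; rewrite big_cons.
Qed.

Lemma has_partial_eq f a b : has_partial f a -> a = b -> has_partial f b.
Proof. by move=> h <-. Qed.

Lemma has_partial_linear (c : 'I_n -> R) :
  has_partial (fun y => \sum_k c k * y 0 k) (c i).
Proof.
apply: has_partial_eq (has_partial_sum (fun k =>
  has_partialZ (c k) (has_partial_coord k))) _.
by rewrite -[RHS](sum_delta i c); apply: eq_bigr => k _; rewrite mulrC.
Qed.

Lemma has_partial_quadratic (c : 'I_n -> 'I_n -> R) :
  has_partial (fun y => \sum_k \sum_l c k l * (y 0 k * y 0 l))
    (\sum_l (c i l + c l i) * x 0 l).
Proof.
apply: has_partial_eq (has_partial_sum (fun k => has_partial_sum (fun l =>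
  has_partialZ (c k l) (has_partialM (has_partial_coord k) (has_partial_coord l))))) _.
transitivity (\sum_k \sum_l (l == i)%:R * (c k l * x 0 k)
  + \sum_k (k == i)%:R * \sum_l c k l * x 0 l).
  rewrite -big_split; apply: eq_bigr => k _ /=; rewrite mulr_sumr -big_split /=.
  by apply: eq_bigr => l _; ring.
rewrite sum_delta; under eq_bigr do rewrite sum_delta.
by rewrite -big_split /=; apply: eq_bigr => k _; ring.
Qed.

Lemma has_partial_sqnorm : has_partial (fun y => dot y y) (2 * x 0 i).
Proof.
apply: has_partial_eq (has_partial_sum (fun k =>
  has_partialM (has_partial_coord k) (has_partial_coord k))) _.
transitivity (\sum_k (k == i)%:R * (2 * x 0 k)); last by rewrite sum_delta.
by apply: eq_bigr => k _; ring.
Qed.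

End HasPartial.

Section Integration.
Variables (R : realType) (n : nat) (U : set 'rV[R]_n) (s : seq 'rV[R]_n).
Hypotheses (n3 : (3 <= n)%N) (oU : open U) (Us : forall x, U x <-> x \notin s).
Variables (f : 'rV[R]_n -> R) (f_smooth : smooth_on U f).

Lemma eq_on_partials (g h : 'rV[R]_n -> R) x0 : U x0 -> smooth_on U g ->
  (forall x i, U x -> has_partial i x h (partial i g x)) ->
  forall x, U x -> g x = h x + (g x0 - h x0).
Proof.
move=> Ux0 sg hh x Ux.
have dg y : U y -> differentiable g y by exact: smooth_on_differentiable.
have i0 : 'I_n by exists 0%N; exact: ltn_trans n3.
have dh y : U y -> differentiable h y by move=> Uy; have [] := hh y i0 Uy.
have := @zero_partials_cst R n U s (fun y => g y - h y) (ltnW n3) Us.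
move=> /(_ (fun y Uy => differentiableB (dg y Uy) (dh y Uy))).
have p0 y i : U y -> partial i (fun y => g y - h y) y = 0.
  move=> Uy; rewrite partialB; [|exact: dg|exact: dh].
  by rewrite (hh y i Uy).2 subrr.
by move=> /(_ p0 x0 x Ux0 Ux) <-; rewrite addrC subrK.
Qed.

Variable t : 'I_n -> 'rV[R]_n -> R.
Hypothesis t_smooth : forall k, smooth_on U (t k).
Hypothesis f3 : forall x, U x -> forall m i j,
  partial m (partial i (partial j f)) x =
    (m == i)%:R * t j x + (m == j)%:R * t i x + (i == j)%:R * t m x.

(** Differentiating [f3] once more and exchanging the two outer derivatives gives
linear relations between the derivatives of t. Choosing an index different from
two given ones, which is possible as n >= 3, they say that the derivative of t is
a multiple of the identity. Differentiating the multiple itself in a direction m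
and computing it from another diagonal entry k, the derivative vanishes. *)
Lemma partial_trace_part : exists c : R, forall x, U x -> forall i j,
  partial i (t j) x = (i == j)%:R * c.
Proof.
have other (i j : 'I_n) : exists m : 'I_n, (m != i) && (m != j).
  apply/existsP; rewrite -[X in is_true X]negbK negb_exists; apply/negP => /forallP h.
  have : (#|{: 'I_n}| <= #|pred2 i j|)%N.
    apply: subset_leq_card; apply/fintype.subsetP => m _.
    by have := h m; rewrite negb_and !negbK !inE.
  by rewrite card_ord card2 leqNgt (leq_trans _ n3) //; case: (_ != _).
have f4 x m i j l : U x -> partial l (partial m (partial i (partial j f))) x =
   (m == i)%:R * partial l (t j) x + (m == j)%:R * partial l (t i) x
   + (i == j)%:R * partial l (t m) x.
  move=> Ux.
  have ht k : has_partial l x (t k) (partial l (t k) x).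
    by split => //; exact: smooth_on_differentiable (t_smooth k) Ux.
  rewrite (partial_ext l oU Ux (fun y Uy => f3 Uy m i j)).
  exact: (has_partialD (has_partialD (has_partialZ _ (ht _)) (has_partialZ _ (ht _)))
    (has_partialZ _ (ht _))).2.
have f4C x m i j l : U x -> partial l (partial m (partial i (partial j f))) x =
    partial m (partial l (partial i (partial j f))) x.
  move=> Ux; have sij : smooth_on U (partial i (partial j f)).
    by do 2!apply: smooth_on_partial.
  exact: (partial_comm oU l m Ux sij).
(* Exchange the derivatives i and m in the component (m, m, j). *)
have off x i j : U x -> i != j -> partial i (t j) x = 0.
  move=> Ux ij; have [m /andP[mi mj]] := other i j.
  have := f4C x m m j i Ux; rewrite !f4 // eqxx (negbTE mj) (negbTE ij).
  by rewrite (eq_sym i m) (negbTE mi) !mul0r mul1r !addr0.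
have diag x i j : U x -> partial i (t i) x = partial j (t j) x.
  move=> Ux; have [->//|ij] := eqVneq i j.
  have := f4C x j j i i Ux; rewrite !f4 // !eqxx (negbTE ij) (eq_sym j i) (negbTE ij).
  by rewrite !mul0r !mul1r !addr0 !add0r.
have i0 : 'I_n by exists 0%N; exact: ltn_trans n3.
have [[x0 Ux0]|noU] := pselect (exists x, U x); last first.
  by exists 0 => x Ux; exfalso; apply: noU; exists x.
exists (partial i0 (t i0) x0) => x Ux i j.
have [->|ij] := eqVneq i j; last by rewrite mul0r off.
rewrite mul1r (diag x j i0 Ux).
apply: (zero_partials_cst (ltnW n3) Us _ _ Ux0 Ux) => [y Uy|y m Uy].
  by apply: smooth_on_differentiable Uy; exact: smooth_on_partial.
have [k /andP[km _]] := other m m.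
rewrite (partial_ext m oU Uy (fun z Uz => diag z i0 k Uz)).
rewrite (partial_comm oU m k Uy (t_smooth k)).
have mk : m != k by rewrite eq_sym.
by rewrite (partial_ext k oU Uy (fun z Uz => off z m k Uz mk)) partial_cst.
Qed.

(** Integrate four times, from t up to f; each primitive is a polynomial, and each
constant of integration is the value of the difference at a base point x0. *)
Lemma quartic_form : exists (l : R) (mu rho : 'I_n -> R) (nu : 'I_n -> 'I_n -> R) (sg : R),
  forall x, U x -> f x = 8^-1 * l * (dot x x * dot x x)
    + 2^-1 * ((\sum_k mu k * x 0 k) * dot x x)
    + 2^-1 * (\sum_i \sum_j nu i j * (x 0 i * x 0 j))
    + \sum_k rho k * x 0 k + sg.
Proof.
have [l hl] := partial_trace_part.
have [[x0 Ux0]|noU] := pselect (exists x, U x); last first.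
  exists 0, (fun=> 0), (fun=> 0), (fun _ _ => 0), 0 => x Ux.
  by exfalso; apply: noU; exists x.
have s1 i : smooth_on U (partial i f) by exact: smooth_on_partial.
have s2 i j : smooth_on U (partial i (partial j f)) by exact: smooth_on_partial.
pose mu k := t k x0 - l * x0 0 k.
have tE k x : U x -> t k x = l * x 0 k + mu k.
  move=> Ux; apply: (@eq_on_partials (t k) (fun y => l * y 0 k) x0) => // y i Uy.
  rewrite hl // (eq_sym i k) mulrC.
  exact: has_partialZ (has_partial_coord i y k).
pose M (x : 'rV[R]_n) := \sum_k mu k * x 0 k.
have hM i x : has_partial i x M (mu i) by exact: has_partial_linear.
have hN (i : 'I_n) (x : 'rV[R]_n) : has_partial i x (fun y => dot y y) (2 * x 0 i) by exact: has_partial_sqnorm.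
pose P2 i j (x : 'rV[R]_n) := (i == j)%:R * (2^-1 * l * dot x x + M x)
   + l * (x 0 i * x 0 j) + mu i * x 0 j + mu j * x 0 i.
pose nu i j := partial i (partial j f) x0 - P2 i j x0.
have f2E i j x : U x -> partial i (partial j f) x = P2 i j x + nu i j.
  move=> Ux; apply: (@eq_on_partials _ (P2 i j) x0) => // y m Uy.
  apply: has_partial_eq (has_partialD (has_partialD (has_partialD
    (has_partialZ _ (has_partialD (has_partialZ _ (hN m y)) (hM m y)))
    (has_partialZ _ (has_partialM (has_partial_coord m y i) (has_partial_coord m y j))))
    (has_partialZ _ (has_partial_coord m y j))) (has_partialZ _ (has_partial_coord m y i))) _.
  by rewrite f3 // !tE // (eq_sym i m) (eq_sym j m); field.
(* Symmetry of the Hessian is inherited by its constant part. *)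
have nu_sym i j : nu i j = nu j i.
  rewrite /nu (partial_comm oU i j Ux0 f_smooth); congr (_ - _).
  by rewrite /P2 (eq_sym i j); ring.
pose P1 j (x : 'rV[R]_n) := 2^-1 * l * (dot x x * x 0 j) + M x * x 0 j
  + 2^-1 * mu j * dot x x + \sum_k nu j k * x 0 k.
pose rho j := partial j f x0 - P1 j x0.
have f1E j x : U x -> partial j f x = P1 j x + rho j.
  move=> Ux; apply: (@eq_on_partials _ (P1 j) x0) => // y i Uy.
  apply: has_partial_eq (has_partialD (has_partialD (has_partialD
    (has_partialZ _ (has_partialM (hN i y) (has_partial_coord i y j)))
    (has_partialM (hM i y) (has_partial_coord i y j)))
    (has_partialZ _ (hN i y))) (has_partial_linear i y _)) _.
  by rewrite f2E // /P2 (eq_sym j i) (nu_sym j i); field.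
pose P0 (x : 'rV[R]_n) := 8^-1 * l * (dot x x * dot x x) + 2^-1 * (M x * dot x x)
  + 2^-1 * (\sum_i \sum_j nu i j * (x 0 i * x 0 j)) + \sum_k rho k * x 0 k.
exists l, mu, rho, nu, (f x0 - P0 x0) => x Ux.
apply: (@eq_on_partials f P0 x0) => // y i Uy.
apply: has_partial_eq (has_partialD (has_partialD (has_partialD
  (has_partialZ _ (has_partialM (hN i y) (hN i y)))
  (has_partialZ _ (has_partialM (hM i y) (hN i y))))
  (has_partialZ _ (has_partial_quadratic i y _))) (has_partial_linear i y _)) _.
rewrite f1E // /P1.
have -> : \sum_k (nu i k + nu k i) * y 0 k = 2 * \sum_k nu i k * y 0 k.
  by rewrite mulr_sumr; apply: eq_bigr => k _; rewrite (nu_sym k i); ring.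
by field.
Qed.

End Integration.

(** * Stereographic coordinates *)

Section HasPartialInv.
Variables (R : realType) (n : nat) (i : 'I_n) (x : 'rV[R]_n).

Lemma has_partialV (f : 'rV[R]_n -> R) a : f x != 0 -> has_partial i x f a ->
  has_partial i x (fun y => (f y)^-1) (- (a * (f x)^-1 ^+ 2)).
Proof.
move=> f0 [df <-]; split; first exact: differentiableV.
rewrite /partial deriveV //; last exact: diff_derivable.
by rewrite -[LHS]/(- (f x ^- 2) * _) mulNr mulrC -exprVn.
Qed.

Lemma derive_coord m (F : 'rV[R]_n -> 'rV[R]_m) (d : 'I_m -> R) k :
  (forall k, has_partial i x (fun y => F y 0 k) (d k)) ->
  ('D_(delta_mx 0 i) F x) 0 k = d k.
Proof.
move=> hF.
have dF : derivable F x (delta_mx 0 i).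
  apply/derivable_mxP => a b; rewrite ord1; apply: diff_derivable.
  exact: (hF b).1.
by rewrite derive_mx // mxE; exact: (hF k).2.
Qed.

End HasPartialInv.

Section DotLemmas.
Variables (R : realType) (n : nat).
Implicit Types (b : bool) (x y z : 'rV[R]_n) (p v w : 'rV[R]_n.+1).

Lemma dot_ge0 x : 0 <= dot x x.
Proof. by apply: sumr_ge0 => i _; rewrite -expr2 sqr_ge0. Qed.

Lemma dot_eq0 x : dot x x = 0 -> x = 0.
Proof.
move/eqP; rewrite /dot psumr_eq0 => [/allP h0|i _]; last by rewrite -expr2 sqr_ge0.
apply/rowP => i; rewrite mxE; have := h0 i; rewrite mem_index_enum => /(_ isT).
by rewrite mulf_eq0 orbb => /eqP.
Qed.

Lemma dotC x y : dot x y = dot y x.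
Proof. by apply: eq_bigr => i _; rewrite mulrC. Qed.

Lemma dotDl x y z : dot (x + y) z = dot x z + dot y z.
Proof. by rewrite /dot -big_split; apply: eq_bigr => i _; rewrite mxE mulrDl. Qed.

Lemma dotZl a x y : dot (a *: x) y = a * dot x y.
Proof. by rewrite /dot mulr_sumr; apply: eq_bigr => i _; rewrite mxE mulrA. Qed.

Lemma dotDr x y z : dot z (x + y) = dot z x + dot z y.
Proof. by rewrite !(dotC z) dotDl. Qed.

Lemma dotZr a x y : dot y (a *: x) = a * dot y x.
Proof. by rewrite !(dotC y) dotZl. Qed.

Lemma dot_recl v w : dot v w = v 0 ord0 * w 0 ord0
  + \sum_(k < n) v 0 (lift ord0 k) * w 0 (lift ord0 k).
Proof. by rewrite /dot big_ord_recl. Qed.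

Lemma sqnormD1_gt0 x : 0 < dot x x + 1.
Proof. by rewrite ltr_wpDl // dot_ge0. Qed.

Lemma stereo0 b x :
  stereo b x 0 ord0 = (-1) ^+ b * (dot x x - 1) * (dot x x + 1)^-1.
Proof.
rewrite /stereo mxE mulrC; congr (_ * _).
rewrite (_ : ord0 = lshift n (ord0 : 'I_1)); last exact: val_inj.
by rewrite row_mxEl mxE eqxx mulr1n.
Qed.

Lemma stereoS b x k :
  stereo b x 0 (lift ord0 k) = 2 * x 0 k * (dot x x + 1)^-1.
Proof.
rewrite /stereo mxE mulrC; congr (_ * _).
rewrite (_ : lift ord0 k = rshift 1 k); last exact: val_inj.
by rewrite row_mxEr mxE.
Qed.

Lemma stereo_sphere b x : dot (stereo b x) (stereo b x) = 1.
Proof.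
rewrite dot_recl stereo0; under eq_bigr do rewrite stereoS.
have -> : \sum_(k < n) 2 * x 0 k * (dot x x + 1)^-1 * (2 * x 0 k * (dot x x + 1)^-1)
  = 4 * (dot x x + 1)^-1 ^+ 2 * dot x x.
  by rewrite /dot mulr_sumr; apply: eq_bigr => k _; ring.
have := sqnormD1_gt0 x; move: (dot x x) => N N0.
have N1 : N + 1 != 0 by rewrite gt_eqF.
by case: b; rewrite /= ?expr1 ?expr0; field.
Qed.

Definition unstereo (b : bool) p : 'rV[R]_n :=
  \row_k (p 0 (lift ord0 k) / (1 - (-1) ^+ b * p 0 ord0)).

Lemma stereoK b x : unstereo b (stereo b x) = x.
Proof.
apply/rowP => k; rewrite mxE stereoS stereo0.
have := sqnormD1_gt0 x; move: (dot x x) (x 0 k) => N y N0.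
have N1 : N + 1 != 0 by rewrite gt_eqF.
by case: b; rewrite /= ?expr1 ?expr0; field; rewrite N1 /=;
  rewrite [X in X != 0](_ : _ = 2) ?pnatr_eq0 //; ring.
Qed.

Lemma stereo_neq_pole b x : (-1) ^+ b * stereo b x 0 ord0 != 1.
Proof.
rewrite stereo0; have := sqnormD1_gt0 x; move: (dot x x) => N N0.
have N1 : N + 1 != 0 by rewrite gt_eqF.
rewrite mulrA mulrA -expr2 sqrr_sign mul1r -subr_eq0.
have -> : (N - 1) / (N + 1) - 1 = - 2 / (N + 1) by field.
by rewrite mulf_neq0 ?invr_eq0 // oppr_eq0 pnatr_eq0.
Qed.

Lemma sqnorm_unstereo b p : dot p p = 1 -> (-1) ^+ b * p 0 ord0 != 1 ->
  dot (unstereo b p) (unstereo b p) =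
  (1 + (-1) ^+ b * p 0 ord0) / (1 - (-1) ^+ b * p 0 ord0).
Proof.
move=> p1 pb; have d0 : 1 - (-1) ^+ b * p 0 ord0 != 0 by rewrite subr_eq0 eq_sym.
have : \sum_(k < n) p 0 (lift ord0 k) * p 0 (lift ord0 k) = 1 - (p 0 ord0) ^+ 2.
  by apply/eqP; rewrite eq_sym subr_eq addrC expr2 -dot_recl p1.
have -> : dot (unstereo b p) (unstereo b p) =
  (\sum_(k < n) p 0 (lift ord0 k) * p 0 (lift ord0 k)) / (1 - (-1) ^+ b * p 0 ord0) ^+ 2.
  rewrite mulr_suml; apply: eq_bigr => k _; rewrite !mxE.
  by field.
have -> : p 0 ord0 ^+ 2 = ((-1) ^+ b * p 0 ord0) ^+ 2 by rewrite exprMn sqrr_sign mul1r.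
by move=> ->; field.
Qed.

Lemma unstereoK b p : dot p p = 1 -> (-1) ^+ b * p 0 ord0 != 1 ->
  stereo b (unstereo b p) = p.
Proof.
move=> p1 pb; have d0 : 1 - (-1) ^+ b * p 0 ord0 != 0 by rewrite subr_eq0 eq_sym.
have N1 : dot (unstereo b p) (unstereo b p) + 1 = 2 / (1 - (-1) ^+ b * p 0 ord0).
  by rewrite sqnorm_unstereo //; field.
apply/rowP => j; case: (unliftP ord0 j) => [k|] ->.
  by rewrite stereoS N1 mxE; field.
rewrite stereo0 N1 sqnorm_unstereo //.
have e2 := sqrr_sign R b; move: d0 e2; move: ((-1) ^+ b) (p 0 ord0) => e y d0 e2.
have -> : e * ((1 + e * y) / (1 - e * y) - 1) / (2 / (1 - e * y)) = e ^+ 2 * y by field.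
by rewrite e2 mul1r.
Qed.

Lemma derive_stereo b i x k : ('D_(delta_mx 0 i) (stereo b) x) 0 k =
  if unlift ord0 k is Some l
  then 2 * (l == i)%:R * (dot x x + 1)^-1 - 4 * x 0 l * x 0 i * (dot x x + 1)^-1 ^+ 2
  else (-1) ^+ b * (4 * x 0 i * (dot x x + 1)^-1 ^+ 2).
Proof.
have N1 : dot x x + 1 != 0 by rewrite gt_eqF // sqnormD1_gt0.
have hN : has_partial i x (fun y => dot y y + 1) (2 * x 0 i).
  have := has_partialD (has_partial_sqnorm i x) (has_partial_cst i x 1).
  by rewrite addr0.
have hr := has_partialV N1 hN.
have hM : has_partial i x (fun y => (-1) ^+ b * (dot y y - 1)) ((-1) ^+ b * (2 * x 0 i)).
  apply: has_partialZ.
  have := has_partialB (has_partial_sqnorm i x) (has_partial_cst i x 1).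
  by rewrite subr0.
pose d (k : 'I_n.+1) := if unlift ord0 k is Some l
  then 2 * (l == i)%:R * (dot x x + 1)^-1 - 4 * x 0 l * x 0 i * (dot x x + 1)^-1 ^+ 2
  else (-1) ^+ b * (4 * x 0 i * (dot x x + 1)^-1 ^+ 2).
rewrite -/(d k); apply: derive_coord => {}k.
case: (unliftP ord0 k) => [l|] ->; rewrite /d.
  rewrite (_ : (fun _ => _) = fun y : 'rV[R]_n => 2 * y 0 l * (dot y y + 1)^-1); last first.
    by apply/funext => y; rewrite stereoS.
  have h2 := has_partialZ 2 (has_partial_coord i x l).
  apply: has_partial_eq (has_partialM h2 hr) _.
  by rewrite liftK; ring.
rewrite (_ : (fun _ => _) = fun y : 'rV[R]_n => (-1) ^+ b * (dot y y - 1) * (dot y y + 1)^-1); last first.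
  by apply/funext => y; rewrite stereo0.
apply: has_partial_eq (has_partialM hM hr) _.
rewrite unlift_none; move: (dot x x) N1 (x 0 i) ((-1) ^+ b) => N N1 y e.
by field.
Qed.

Lemma derive_stereo0 b i x : ('D_(delta_mx 0 i) (stereo b) x) 0 ord0 =
  (-1) ^+ b * (4 * x 0 i * (dot x x + 1)^-1 ^+ 2).
Proof. by rewrite derive_stereo unlift_none. Qed.

Lemma derive_stereoS b i x k : ('D_(delta_mx 0 i) (stereo b) x) 0 (lift ord0 k) =
  2 * (k == i)%:R * (dot x x + 1)^-1 - 4 * x 0 k * x 0 i * (dot x x + 1)^-1 ^+ 2.
Proof. by rewrite derive_stereo liftK. Qed.

(** Stereographic projection is conformal, with factor 4 / (1 + |x|^2)^2. *)
Lemma dot_derive_stereo b i j x :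
  dot ('D_(delta_mx 0 i) (stereo b) x) ('D_(delta_mx 0 j) (stereo b) x)
  = (i == j)%:R * (4 / (dot x x + 1) ^+ 2).
Proof.
have N1 : dot x x + 1 != 0 by rewrite gt_eqF // sqnormD1_gt0.
have e0 l := derive_stereo0 b l x; have eS l := derive_stereoS b l x.
move: ('D_(delta_mx 0 i) (stereo b) x) ('D_(delta_mx 0 j) (stereo b) x)
  (e0 i) (e0 j) (eS i) (eS j) => v w v0 w0 vS wS.
rewrite (dot_recl v w) v0 w0 {e0 eS v0 w0}.
have -> : \sum_(k < n) v 0 (lift ord0 k) * w 0 (lift ord0 k) =
  \sum_(k < n) ((k == i)%:R * ((k == j)%:R * (4 / (dot x x + 1) ^+ 2)
     - 8 * x 0 k * x 0 j / (dot x x + 1) ^+ 3)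
   - (k == j)%:R * (8 * x 0 k * x 0 i / (dot x x + 1) ^+ 3)
   + 16 * x 0 i * x 0 j / (dot x x + 1) ^+ 4 * (x 0 k * x 0 k)).
  by apply: eq_bigr => k _; rewrite vS wS; field.
rewrite big_split sumrB /= !sum_delta -mulr_sumr -/(dot x x).
have := sqrr_sign R b; rewrite expr2.
move: (dot x x) N1 ((-1) ^+ b) (x 0 i) (x 0 j) => N N1 e xi xj e2.
have -> : e * (4 * xi * (N + 1)^-1 ^+ 2) * (e * (4 * xj * (N + 1)^-1 ^+ 2)) =
   (e * e) * (16 * xi * xj / (N + 1) ^+ 4) by field.
by rewrite e2; field.
Qed.

Lemma tangent_derive_stereo b i x :
  dot (stereo b x) ('D_(delta_mx 0 i) (stereo b) x) = 0.
Proof.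
have N1 : dot x x + 1 != 0 by rewrite gt_eqF // sqnormD1_gt0.
move: ('D_(delta_mx 0 i) (stereo b) x) (derive_stereo0 b i x) (derive_stereoS b i x).
move=> v v0 vS; rewrite (dot_recl (stereo b x) v) v0 stereo0.
have -> : \sum_(k < n) stereo b x 0 (lift ord0 k) * v 0 (lift ord0 k) =
  \sum_(k < n) ((k == i)%:R * (4 * x 0 k / (dot x x + 1) ^+ 2)
   - 8 * x 0 i / (dot x x + 1) ^+ 3 * (x 0 k * x 0 k)).
  by apply: eq_bigr => k _; rewrite vS stereoS; field.
rewrite sumrB /= !sum_delta -mulr_sumr -/(dot x x).
have := sqrr_sign R b; rewrite expr2.
move: (dot x x) N1 ((-1) ^+ b) (x 0 i) => N N1 e xi e2.
have -> : e * (N - 1) / (N + 1) * (e * (4 * xi * (N + 1)^-1 ^+ 2)) =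
   (e * e) * (4 * xi * (N - 1) / (N + 1) ^+ 3) by field.
by rewrite e2; field.
Qed.

End DotLemmas.

(** * Quadratic polynomials on the sphere *)

Section Quadratic.
Variables (R : realType) (m : nat).
Implicit Types (p : 'rV[R]_m.+1) (L q : 'rV[R]_m.+1 -> R).

Definition bary (p1 p2 p3 : 'rV[R]_m.+1) (a b c : R) : 'rV[R]_m.+1 :=
  (a + b + c)^-1 *: (a *: p1 + b *: p2 + c *: p3).

(** The two analytic facts about polynomials on the sphere that matter for lengths. *)
Definition regular q : Prop := (forall p, differentiable q p) /\
  exists C, forall p, dot p p = 1 -> `|q p| <= C.

Definition affine L : Prop := regular L /\
  forall p1 p2 p3 a b c, a + b + c != 0 ->
    (a + b + c) * L (bary p1 p2 p3 a b c) = a * L p1 + b * L p2 + c * L p3.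

(** The last clause is the expansion of the homogenized quadratic form at
a (1, p1) + b (1, p2) + c (1, p3), in which B12, B13 and B23 are the values of twice
the polar form. In this shape it is stable under the operations below and can be
used directly on a circle through three points. *)
Definition quadratic q : Prop := regular q /\
  forall p1 p2 p3, exists B12 B13 B23, forall a b c, a + b + c != 0 ->
    (a + b + c) ^+ 2 * q (bary p1 p2 p3 a b c) =
    a ^+ 2 * q p1 + b ^+ 2 * q p2 + c ^+ 2 * q p3
    + a * b * B12 + a * c * B13 + b * c * B23.

Lemma regularD q q' : regular q -> regular q' -> regular (fun p => q p + q' p).
Proof.
move=> [d [C hC]] [d' [C' hC']]; split; first by move=> p; apply: differentiableD.
exists (C + C') => p p1; apply: le_trans (ler_normD _ _) _.
by apply: lerD; [exact: hC | exact: hC'].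
Qed.

Lemma regularM q q' : regular q -> regular q' -> regular (fun p => q p * q' p).
Proof.
move=> [d [C hC]] [d' [C' hC']]; split; first by move=> p; apply: differentiableM.
exists (C * C') => p p1; rewrite normrM.
by apply: ler_pM => //; [exact: hC | exact: hC'].
Qed.

Lemma regular_cst (r : R) : regular (fun=> r).
Proof. by split; [move=> p; exact: differentiable_cst | exists `|r|]. Qed.

Lemma regular_coord k : regular (fun p => p 0 k).
Proof.
split; first by move=> p; exact: differentiable_coord.
exists 1 => p p1; rewrite -(@ler_pXn2r _ 2) ?nnegrE // expr1n -p1 /dot (bigD1 k) //=.
rewrite real_normK ?num_real // expr2 lerDl.
by apply: sumr_ge0 => i _; rewrite -expr2 sqr_ge0.
Qed.

Lemma affine_cst (r : R) : affine (fun=> r).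
Proof. by split; [exact: regular_cst | move=> *; rewrite !mulrDl]. Qed.

Lemma affine_coord k : affine (fun p => p 0 k).
Proof.
split; first exact: regular_coord.
by move=> p1 p2 p3 a b c s0; rewrite /bary !mxE mulrA divff // mul1r.
Qed.

Lemma affineD L L' : affine L -> affine L' -> affine (fun p => L p + L' p).
Proof.
move=> [r h] [r' h']; split; first exact: regularD.
by move=> p1 p2 p3 a b c s0; rewrite mulrDr h // h' //; ring.
Qed.

Lemma affineZ (r : R) L : affine L -> affine (fun p => r * L p).
Proof.
move=> [hL h]; split; first by apply: regularM => //; exact: regular_cst.
by move=> p1 p2 p3 a b c s0; rewrite mulrCA h //; ring.
Qed.

Lemma affine_sum (I : finType) (F : I -> 'rV[R]_m.+1 -> R) :
  (forall k, affine (F k)) -> affine (fun p => \sum_k F k p).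
Proof.
move=> hF; suff h (s : seq I) : affine (fun p => \sum_(k <- s) F k p) by exact: h.
elim: s => [|k s IH].
  rewrite (_ : (fun _ => _) = fun=> 0); first exact: affine_cst.
  by apply/funext => p; rewrite big_nil.
rewrite (_ : (fun _ => _) = fun p => F k p + \sum_(j <- s) F j p).
  exact: affineD.
by apply/funext => p; rewrite big_cons.
Qed.

Lemma quadraticM L L' : affine L -> affine L' -> quadratic (fun p => L p * L' p).
Proof.
move=> [r h] [r' h']; split; first exact: regularM.
move=> p1 p2 p3; exists (L p1 * L' p2 + L p2 * L' p1),
  (L p1 * L' p3 + L p3 * L' p1), (L p2 * L' p3 + L p3 * L' p2) => a b c s0.
by rewrite expr2 mulrACA h // h' //; ring.
Qed.

Lemma quadraticD q q' : quadratic q -> quadratic q' -> quadratic (fun p => q p + q' p).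
Proof.
move=> [r h] [r' h']; split; first exact: regularD.
move=> p1 p2 p3; have [x [y [z H]]] := h p1 p2 p3; have [x' [y' [z' H']]] := h' p1 p2 p3.
by exists (x + x'), (y + y'), (z + z') => a b c s0; rewrite mulrDr H // H' //; ring.
Qed.

Lemma quadraticZ (r : R) q : quadratic q -> quadratic (fun p => r * q p).
Proof.
move=> [hq h]; split; first by apply: regularM => //; exact: regular_cst.
move=> p1 p2 p3; have [x [y [z H]]] := h p1 p2 p3.
by exists (r * x), (r * y), (r * z) => a b c s0; rewrite mulrCA H //; ring.
Qed.

Lemma quadratic0 : quadratic (fun=> 0).
Proof.
split; first exact: regular_cst.
by move=> p1 p2 p3; exists 0, 0, 0 => a b c s0; rewrite !mulr0 !addr0.
Qed.

Lemma quadratic_sum (I : finType) (F : I -> 'rV[R]_m.+1 -> R) :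
  (forall k, quadratic (F k)) -> quadratic (fun p => \sum_k F k p).
Proof.
move=> hF; suff h (s : seq I) : quadratic (fun p => \sum_(k <- s) F k p) by exact: h.
elim: s => [|k s IH].
  rewrite (_ : (fun _ => _) = fun=> 0); first exact: quadratic0.
  by apply/funext => p; rewrite big_nil.
rewrite (_ : (fun _ => _) = fun p => F k p + \sum_(j <- s) F j p).
  exact: quadraticD.
by apply/funext => p; rewrite big_cons.
Qed.

End Quadratic.

(** If p is the image of x and p' consists of its last coordinates, then (1 - p0) times
the triple (1, x, |x|^2) is (1 - p0, p', 1 + p0); so a quadratic form in the triple,
multiplied by (1 - p0)^2, is a quadratic polynomial in p. *)
Lemma quartic_to_sphere (R : realType) (n : nat)
    (l : R) (mu rho : 'I_n -> R) (nu : 'I_n -> 'I_n -> R) (sg : R) :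
  exists2 q : 'rV[R]_n.+1 -> R, quadratic q & forall x,
   q (stereo false x) = 4 / (dot x x + 1) ^+ 2 *
   (8^-1 * l * (dot x x * dot x x)
    + 2^-1 * ((\sum_k mu k * x 0 k) * dot x x)
    + 2^-1 * (\sum_i \sum_j nu i j * (x 0 i * x 0 j))
    + \sum_k rho k * x 0 k + sg).
Proof.
pose N (p : 'rV[R]_n.+1) := 1 + p 0 ord0.
pose D (p : 'rV[R]_n.+1) := 1 + (-1) * p 0 ord0.
pose Lin (c : 'I_n -> R) (p : 'rV[R]_n.+1) := \sum_k c k * p 0 (lift ord0 k).
have aN : affine N by apply: affineD; [exact: affine_cst | exact: affine_coord].
have aD : affine D.
  by apply: affineD; [exact: affine_cst | apply: affineZ; exact: affine_coord].
have aLin c : affine (Lin c).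
  by apply: affine_sum => k; apply: affineZ; exact: affine_coord.
exists (fun p => 8^-1 * l * (N p * N p) + 2^-1 * (Lin mu p * N p)
  + 2^-1 * (\sum_i \sum_j nu i j * (p 0 (lift ord0 i) * p 0 (lift ord0 j)))
  + Lin rho p * D p + sg * (D p * D p)).
  apply: quadraticD; last by apply: quadraticZ; exact: quadraticM.
  apply: quadraticD; last exact: quadraticM.
  apply: quadraticD.
    by apply: quadraticD; apply: quadraticZ; exact: quadraticM.
  apply: quadraticZ; apply: quadratic_sum => i; apply: quadratic_sum => j.
  by apply: quadraticZ; apply: quadraticM; exact: affine_coord.
move=> x; have N1 : dot x x + 1 != 0 by rewrite gt_eqF // sqnormD1_gt0.
have eN : N (stereo false x) = 2 * dot x x / (dot x x + 1).
  by rewrite /N stereo0 expr0; field.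
have eD : D (stereo false x) = 2 / (dot x x + 1).
  by rewrite /D stereo0 expr0; field.
have eLin c : Lin c (stereo false x) = 2 / (dot x x + 1) * \sum_k c k * x 0 k.
  by rewrite mulr_sumr; apply: eq_bigr => k _; rewrite stereoS; field.
have -> : \sum_i \sum_j nu i j *
    (stereo false x 0 (lift ord0 i) * stereo false x 0 (lift ord0 j)) =
    4 / (dot x x + 1) ^+ 2 * \sum_i \sum_j nu i j * (x 0 i * x 0 j).
  rewrite mulr_sumr; apply: eq_bigr => i _; rewrite mulr_sumr; apply: eq_bigr => j _.
  by rewrite !stereoS; field.
rewrite !eLin eN eD.
move: (dot x x) N1 (\sum_i _) (\sum_k _) (\sum_k _) => y y1 s1 s2 s3.
by field.
Qed.

Lemma open_notin (R : realType) (n : nat) (s : seq 'rV[R]_n) : open [set x | x \notin s].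
Proof.
rewrite (_ : [set x | x \notin s] = ~` [set` s]); last first.
  by apply/seteqP; split => x /= /negP.
have acc : accessible_space 'rV[R]_n.
  exact/hausdorff_accessible/norm_hausdorff.
have h := (@accessible_finite_set_closed _).1 acc.
by apply: closed_openC; apply: h; exact: finite_seq.
Qed.

(** * The conformal factor of a metric with parallel Ricci tensor *)

Lemma smooth_on_sqnormD1 (R : realType) (n : nat) (U : set 'rV[R]_n) : open U ->
  smooth_on U (fun x => dot x x + 1).
Proof.
move=> oU; apply: smooth_onD => //; last exact: smooth_on_cst.
by apply: smooth_on_sum => // i; apply: smooth_onM => //; exact: smooth_on_coord.
Qed.

Lemma stereo_pole (R : realType) (n : nat) (x : 'rV[R]_n) :
  stereo true x 0 ord0 = 1 -> x = 0.
Proof.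
rewrite stereo0 expr1 => h.
have N1 : dot x x + 1 != 0 by rewrite gt_eqF // sqnormD1_gt0.
apply: dot_eq0.
by move: h => /(congr1 ( *%R^~ (dot x x + 1))); rewrite divfK // mul1r; lra.
Qed.

Lemma differentiable_rV (R : realType) (V : normedModType R) (m : nat)
    (F : V -> 'rV[R]_m) (x : V) :
  (forall k, differentiable (fun y => F y 0 k) x) -> differentiable F x.
Proof.
move=> dF.
have -> : F = \sum_(j < m) (fun y => F y 0 j *: delta_mx 0 j).
  apply/funext => y; rewrite {1}(row_sum_delta (F y)).
  by elim/big_rec2: _ => // j a c _ ->.
by apply: differentiable_sum => j; exact: differentiableZl.
Qed.

Lemma smooth_stereo_coord (R : realType) (n : nat) b j :
  smooth_on setT (fun y : 'rV[R]_n => stereo b y 0 j).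
Proof.
have oT : open (@setT 'rV[R]_n) by exact: openT.
have sr : smooth_on setT (fun y : 'rV[R]_n => (dot y y + 1)^-1).
  apply: smooth_onV => // [y _|]; first exact: sqnormD1_gt0.
  exact: smooth_on_sqnormD1.
case: (unliftP ord0 j) => [l|] ->.
  apply: (smooth_on_ext oT (f := fun y : 'rV[R]_n => 2 * y 0 l * (dot y y + 1)^-1)).
    by move=> y _; rewrite stereoS.
  apply: smooth_onM => //; apply: smooth_onM => //; first exact: smooth_on_cst.
  exact: smooth_on_coord.
apply: (smooth_on_ext oT (f := fun y : 'rV[R]_n => (-1) ^+ b * (dot y y + 1 - 2) * (dot y y + 1)^-1)).
  by move=> y _; rewrite stereo0; congr (_ * _ * _); ring.
apply: smooth_onM => //; apply: smooth_onM => //; first exact: smooth_on_cst.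
by apply: smooth_onB => //; [exact: smooth_on_sqnormD1 | exact: smooth_on_cst].
Qed.

Lemma differentiable_stereo (R : realType) (n : nat) b (x : 'rV[R]_n) :
  differentiable (stereo b : 'rV[R]_n -> _) x.
Proof.
apply: differentiable_rV => k.
exact: (@smooth_on_differentiable _ _ setT _ x (smooth_stereo_coord b k) I).
Qed.

Section ConformalFactor.
Variables (R : realType) (n k : nat) (n3 : (3 <= n)%N) (p : 'I_k -> 'rV[R]_n.+1).
Hypothesis p_sphere : forall i, sphere R n (p i).
Let M := sphere R n `\` range p.
Variable u : 'rV[R]_n.+1 -> R.
Hypotheses (u_smooth : smooth_on_sphere M u) (u_gt0 : forall x, M x -> 0 < u x).
Let w x := u x `^ (4 / (n%:R - 2)).

Definition punctures (b : bool) : seq 'rV[R]_n :=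
  [seq unstereo b (p i) | i <- enum 'I_k & (-1) ^+ b * p i 0 ord0 != 1].

Lemma stereo_preimage b x : (stereo b @^-1` M) x <-> x \notin punctures b.
Proof.
split.
  move=> [_ xp]; apply/negP => /mapP[i]; rewrite mem_filter => /andP[pi1 _] xE.
  by apply: xp; exists i => //; rewrite xE unstereoK //; exact: p_sphere.
move=> /negP xs; split; first exact: stereo_sphere.
move=> [i _ pix]; apply: xs; apply/mapP; exists i; last by rewrite pix stereoK.
by rewrite mem_filter mem_enum pix stereo_neq_pole.
Qed.

Lemma open_stereo_preimage b : open (stereo b @^-1` M).
Proof.
rewrite (_ : _ @^-1` _ = [set x | x \notin punctures b]); first exact: open_notin.
by apply/seteqP; split => x /stereo_preimage.
Qed.

Lemma conformal_factor_smooth b : smooth_on (stereo b @^-1` M) (w \o stereo b).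
Proof.
have h0 x : (stereo b @^-1` M) x -> 0 < (u \o stereo b) x by exact: u_gt0.
exact: (smooth_on_powR (@open_stereo_preimage b) (4 / (n%:R - 2)) h0 (@u_smooth b)).
Qed.

Variable g : tensor_field R n.
Hypothesis gE : tensor_eq_on M g (fun x v z => w x * standard_metric R n x v z).

Lemma in_chart_conformal b x : M (stereo b x) ->
  in_chart g b x = (4 * w (stereo b x) / (dot x x + 1) ^+ 2)%:M.
Proof.
move=> Mx; apply/matrixP => i j; rewrite !mxE gE //; try exact: tangent_derive_stereo.
rewrite /standard_metric dot_derive_stereo.
by case: (i == j); rewrite ?mul0r ?mulr0 ?mulr0n ?mulr1n ?mul1r // mulrA (mulrC _ 4).
Qed.

Hypothesis par : parallel_ricci M g.

(** In the chart centred at the pole -e_0 the previous parts apply to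
f = (1 + |x|^2)^2 / (4 w). *)
Lemma conformal_factor_quadratic_off_pole :
  exists2 q, quadratic q & forall x, M x -> x 0 ord0 != 1 -> q x * w x = 1.
Proof.
set U := stereo false @^-1` M.
have oU : open U := @open_stereo_preimage false.
have sw := @conformal_factor_smooth false.
have w0 x : U x -> 0 < w (stereo false x) by move=> Ux; exact/powR_gt0/u_gt0.
have sN : smooth_on U (fun x => dot x x + 1).
  exact: smooth_on_sqnormD1.
(* The reciprocal of the factor found in [in_chart_conformal]. *)
pose f x := 4^-1 * ((dot x x + 1) * (dot x x + 1)) * (w (stereo false x))^-1.
have sf : smooth_on U f.
  apply: smooth_onM => //; last by apply: smooth_onV => //.
  by apply: smooth_onM => //; [exact: smooth_on_cst | exact: smooth_onM].
have f0 x : U x -> 0 < f x.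
  by move=> Ux; rewrite !mulr_gt0 ?invr_gt0 ?sqnormD1_gt0 ?w0.
have hE x : U x -> in_chart g false x = (f x)^-1%:M.
  move=> Ux; rewrite in_chart_conformal //; congr (_%:M).
  have := w0 x Ux; have := sqnormD1_gt0 x; rewrite /f.
  move: (dot x x + 1) (w _) => y z y0 z0; field.
  by rewrite !gt_eqF.
have par' x : U x -> forall m i j,
    covariant_derivative (in_chart g false) (ricci (in_chart g false)) m i j x = 0.
  by move=> Ux; exact: par.
have h3 := parallel_third_derivatives oU sf f0 hE n3 par'.
pose t (j : 'I_n) (x : 'rV[R]_n) := partial j (partial j (partial j f)) x / 3.
have st j : smooth_on U (t j).
  by apply: smooth_onM => //; [do 3!apply: smooth_on_partial | exact: smooth_on_cst].
have [l [mu [rho [nu [sg fE]]]]] := quartic_form n3 oU (stereo_preimage false) sf st h3.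
have [q quad_q qE] := quartic_to_sphere l mu rho nu sg.
exists q => // x Mx x0.
have x1 : (-1) ^+ false * x 0 ord0 != 1 by rewrite expr0 mul1r.
have xE := unstereoK Mx.1 x1.
move: (unstereo false x) xE => y xE; rewrite -xE in Mx *.
rewrite qE -fE // /f.
have := w0 y Mx; have := sqnormD1_gt0 y.
move: (dot y y + 1) (w _) => a z a0 z0; field.
by rewrite !gt_eqF.
Qed.

(** If the pole e_0 has not been removed, the identity extends to it by continuity in
the other chart. *)
Lemma conformal_factor_quadratic :
  exists2 q, quadratic q & forall x, M x -> q x * w x = 1.
Proof.
have [q quad_q qE] := conformal_factor_quadratic_off_pole.
exists q => // x Mx; have [x0|] := eqVneq (x 0 ord0) 1; last exact: qE.
have x1 : (-1) ^+ true * x 0 ord0 != 1.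
  by rewrite x0 expr1 mulr1 eq_sym -subr_eq0 opprK paddr_eq0 ?ler01 // oner_eq0.
have xE := unstereoK Mx.1 x1.
move: (unstereo true x) xE => y xE; rewrite -xE in Mx x0 *.
set phi := fun z => q (stereo true z) * w (stereo true z).
rewrite -/(phi y).
have dphi : differentiable phi y.
  apply: differentiableM.
    by apply: differentiable_comp; [exact: differentiable_stereo | exact: quad_q.1.1].
  exact: smooth_on_differentiable (@conformal_factor_smooth true) Mx.
have cphi := differentiable_continuous dphi.
apply/eqP; rewrite -subr_eq0 -normr_le0; apply/ler_addgt0Pr => e e0; rewrite add0r.
have nA : nbhs y [set z | `|phi y - phi z| < e] by move: cphi => /cvgrPdist_lt/(_ _ e0).
have nU : nbhs y (stereo true @^-1` M).
  exact: open_nbhs_nbhs (conj (@open_stereo_preimage true) Mx).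
have i0 : 'I_n by exists 0%N; exact: ltn_trans n3.
have [r r0 hr] := nbhs_segment (delta_mx 0 i0) (filterI nA nU).
have r0r : 0 < r <= r by rewrite r0 lexx.
have [/= zA Mz] := hr r r0r; set z := y + r *: _ in zA Mz.
have z1 : stereo true z 0 ord0 != 1.
  apply/eqP => /stereo_pole z0; have := congr1 (fun v : 'rV[R]_n => v 0 i0) z0.
  by rewrite /z (stereo_pole x0) add0r !mxE !eqxx mulr1 => r_eq0; move: r0; rewrite r_eq0 ltxx.
by move: zA; rewrite [phi z](qE _ Mz z1) => /ltW.
Qed.

End ConformalFactor.

(** * Lower bounds for the Riemannian distance *)

Section LowerIntegral.
Local Open Scope ereal_scope.

(** The integral of a nonnegative function is the supremum of the integrals of the
simple functions below it, so monotonicity is an inclusion of families of simple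
functions. The lemma is used for the speed of a curve, which takes arbitrary values
at the breakpoints and whose measurability is not given. *)
Lemma le_ge0_integral (d : measure_display) (T : measurableType d) (R : realType)
    (mu : {measure set T -> \bar R}) (D : set T) (f g : T -> \bar R) :
  (forall x, D x -> 0 <= f x) -> (forall x, D x -> f x <= g x) ->
  \int[mu]_(x in D) f x <= \int[mu]_(x in D) g x.
Proof.
move=> f0 fg; have g0 x : D x -> 0 <= g x.
  by move=> Dx; exact: le_trans (f0 x Dx) (fg x Dx).
rewrite !ge0_integralE //; apply: ereal_sup_le => _ [h hf <-]; exists h => // x.
apply: le_trans (hf x) _; rewrite !patchE; case: ifPn => // /set_mem; exact: fg.
Qed.

End LowerIntegral.

Section CurveCoordinate.
Variables (R : realType) (m : nat).
Implicit Types (c d : R -> 'rV[R]_m.+1).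

Lemma derive1_coord d k t : derivable d t 1 ->
  derivable (fun s => d s 0 k) t 1 /\ derive1 (fun s => d s 0 k) t = derive1 d t 0 k.
Proof.
move=> dd; split; first exact: ((derivable_mxP _ _ _).1 dd).
by rewrite !derive1E derive_mx // mxE.
Qed.

Lemma C1_coord_increment d k a b : a < b -> (forall t, derivable d t 1) ->
  continuous (derive1 d) ->
  (`|d b 0 k - d a 0 k|%:E <=
   \int[lebesgue_measure]_(t in `]a, b[) `|derive1 d t 0 k|%:E)%E.
Proof.
move=> ab dd cd; pose f : R -> R := fun t => derive1 d t 0 k.
have cf : continuous f.
  move=> t; apply: (@continuous_comp _ _ _ (derive1 d) (fun v : 'rV[R]_m.+1 => v 0 k)).
    exact: cd.
  exact: coord_continuous.
have mfT : measurable_fun setT f by exact: continuous_measurable_fun.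
have mf : measurable_fun `]a, b[ (EFin \o f).
  by apply: measurableT_comp => //; exact: measurable_funTS.
have E : (\int[lebesgue_measure]_(t in `[a, b]) (f t)%:E = (d b 0 k)%:E - (d a 0 k)%:E)%E.
  apply: (@continuous_FTC2 R f (fun t => d t 0 k)) => //.
  - exact: continuous_subspaceT.
  - split.
    + by move=> t _; exact: (derive1_coord k (dd t)).1.
    + apply: cvg_at_right_filter; apply: differentiable_continuous.
      by apply/derivable1_diffP; exact: (derive1_coord k (dd a)).1.
    + apply: cvg_at_left_filter; apply: differentiable_continuous.
      by apply/derivable1_diffP; exact: (derive1_coord k (dd b)).1.
  - by move=> t _; exact: (derive1_coord k (dd t)).2.
rewrite (@integral_itv_bndoo _ _ _ _ true false mf) in E.
have := @le_abse_integral _ _ R lebesgue_measure `]a, b[ (EFin \o f) _ mf.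
by rewrite [X in (`|X|)%E]E /=; apply; exact: measurable_itv.
Qed.

(** A measurable function below one coordinate of the speed whose integral still
controls the increment of that coordinate. It vanishes outside ]x, y[, so that the
minorants of consecutive pieces can be added. *)
Definition speed_minorant c (k : 'I_m.+1) (x y : R) (phi : R -> R) :=
  [/\ measurable_fun setT phi, forall t, 0 <= phi t,
      forall t, phi t != 0 ->
        [/\ x < t < y, derivable c t 1 & phi t <= `|derive1 c t 0 k|] &
      (`|c y 0 k - c x 0 k|%:E <= \int[lebesgue_measure]_t (phi t)%:E)%E].

Lemma C1_on_minorant c k a b : a < b -> C1_on a b c -> exists phi, speed_minorant c k a b phi.
Proof.
move=> ab [d [dd cd dc]].
have cc : continuous (fun t => derive1 d t 0 k).
  move=> t; apply: (@continuous_comp _ _ _ (derive1 d) (fun v : 'rV[R]_m.+1 => v 0 k)).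
    exact: cd.
  exact: coord_continuous.
have mc : measurable_fun setT (fun t => `|derive1 d t 0 k|).
  apply: measurableT_comp => //.
  exact: continuous_measurable_fun.
have mab : measurable (`]a, b[%classic : set R) by exact: measurable_itv.
exists ((fun t => `|derive1 d t 0 k|) \_ `]a, b[); split.
- apply/(measurable_restrictT (fun t => `|derive1 d t 0 k|) mab).
  exact: (@measurable_funTS _ _ _ _ _ _ mc).
- by move=> t; rewrite patchE; case: ifP.
- move=> t; rewrite patchE; case: ifPn => [|_]; last by rewrite eqxx.
  rewrite inE /= in_itv /= => tab _.
  have ncd : \forall s \near t, d s = c s.
    have tb : t \in `]a, b[%R by rewrite in_itv.
    apply: filterS (near_in_itvoo tb) => s; rewrite in_itv /= => /andP[as_ sb].
    by rewrite dc // !ltW.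
  split => //; first exact: (near_eq_derivable ncd (dd t)).
  have e : 'D_(1 : R) d t = 'D_(1 : R) c t by exact: near_eq_derive.
  by rewrite !derive1E e.
- have ea : c a = d a by apply: dc; rewrite lexx ltW.
  have eb : c b = d b by apply: dc; rewrite lexx ltW.
  rewrite ea eb.
  apply: le_trans (C1_coord_increment k ab dd cd) _.
  rewrite integral_mkcond; apply: le_ge0_integral => t _.
    by rewrite patchE; case: ifP => // _; rewrite lee_fin.
  by rewrite !patchE; case: ifP.
Qed.

Lemma piecewise_minorant c k (s : seq R) (x : R) : path <%R x s ->
  (forall i, (i < size s)%N -> C1_on (nth 0 (x :: s) i) (nth 0 (x :: s) i.+1) c) ->
  exists phi, speed_minorant c k x (last x s) phi.
Proof.
elim: s x => [|y s IH] x /=.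
  move=> _ _; exists (fun=> 0); split => //.
  - by move=> t; rewrite eqxx.
  - by rewrite subrr normr0 integral0.
move=> /andP[xy pys] hC.
have [phi [mphi phi0 phiS phiI]] := IH y pys (fun i hi => hC i.+1 hi).
have [psi [mpsi psi0 psiS psiI]] := C1_on_minorant k xy (hC 0%N isT).
have yl : y <= last y s.
  have := pys; rewrite lt_path_sortedE => /andP[/allP h _].
  have := mem_last y s; rewrite inE => /orP[/eqP -> //|/h /ltW //].
exists (fun t => psi t + phi t); split.
- exact: measurable_funD.
- by move=> t; rewrite addr_ge0.
- move=> t; have [e|/psiS[/andP[xt ty] dt le]] := eqVneq (psi t) 0.
    rewrite e add0r => /phiS[/andP[yt tl] dt le]; split => //.
    by rewrite tl (lt_trans xy yt).
  have -> : phi t = 0.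
    apply/eqP; rewrite -[_ == _]negbK; apply/negP => /phiS[/andP[yt _] _ _].
    by move: (lt_trans yt ty); rewrite ltxx.
  rewrite addr0 => _; split => //.
  by rewrite xt (lt_le_trans ty yl).
- under eq_integral do rewrite EFinD.
  rewrite ge0_integralD //; last 4 first.
  + by move=> t _; rewrite lee_fin.
  + by apply: measurableT_comp.
  + by move=> t _; rewrite lee_fin.
  + by apply: measurableT_comp.
  apply: le_trans (leeD psiI phiI); rewrite -EFinD lee_fin.
  have -> : c (last y s) 0 k - c x 0 k = (c y 0 k - c x 0 k) + (c (last y s) 0 k - c y 0 k).
    by ring.
  exact: ler_normD.
Qed.

End CurveCoordinate.

Section DistanceBounds.
Variables (R : realType) (n : nat) (M : set 'rV[R]_n.+1) (g : tensor_field R n).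
Variable w : 'rV[R]_n.+1 -> R.
Hypothesis M_sphere : forall x, M x -> dot x x = 1.
Hypothesis gE : tensor_eq_on M g (fun x v z => w x * dot v z).

(** Differentiate the equation dot (c s) (c s) = 1. *)
Lemma tangent_velocity (c : R -> 'rV[R]_n.+1) (t : R) : derivable c t 1 ->
  (\forall s \near t, M (c s)) -> dot (c t) (derive1 c t) = 0.
Proof.
move=> dc Mc.
have dck k := (derivable_mxP _ _ _).1 dc 0 k.
have h : is_derive t 1 (\sum_k (fun s => c s 0 k) * (fun s => c s 0 k))
   (\sum_k (c t 0 k *: 'D_1 (fun s => c s 0 k) t + c t 0 k *: 'D_1 (fun s => c s 0 k) t)).
  apply: is_derive_sum => k.
  by apply: is_deriveM; apply: derivableP; exact: dck.
have e : 'D_1 (\sum_k (fun s => c s 0 k) * (fun s => c s 0 k)) t = 0.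
  rewrite -(derive_cst (1 : R) t 1); apply: near_eq_derive.
  apply: filterS Mc => s Ms; rewrite fct_sumE /= -(M_sphere Ms).
  by apply: eq_bigr.
have := @derive_val _ _ _ _ _ _ _ h; rewrite e => /esym.
rewrite big_split /= -mulr2n => /eqP; rewrite mulrn_eq0 /= => /eqP H.
by rewrite -[RHS]H; apply: eq_bigr => k _; rewrite derive1E derive_mx // mxE.
Qed.

(** For every curve, the integral of a coordinate of the Euclidean speed bounds the
increment of that coordinate, and the speed for g is at least kappa times it. *)
Lemma coord_le_distance (kappa : R) k (x y : 'rV[R]_n.+1) : 0 < kappa ->
  (forall z, M z -> kappa ^+ 2 <= w z) ->
  ((kappa * `|y 0 k - x 0 k|)%:E <= riemannian_distance M g x y)%E.
Proof.
move=> k0 kw; apply: le_ereal_inf_tmp => _ [c [[s [ps ls hs]] Mc c0 c1] <-].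
have [phi [mphi phi0 phiS phiI]] := piecewise_minorant k ps hs.
rewrite ls c0 c1 in phiS phiI.
have mphiE : measurable_fun setT (EFin \o phi) by apply: measurableT_comp.
have phiE0 t : (setT : set R) t -> (0 <= (EFin \o phi) t)%E by rewrite lee_fin.
apply: (@le_trans _ _ (\int[lebesgue_measure]_t (kappa%:E * (phi t)%:E))%E).
  have -> : (\int[lebesgue_measure]_t (kappa%:E * (phi t)%:E) =
      kappa%:E * \int[lebesgue_measure]_t (phi t)%:E)%E.
    have k0' : (0 <= kappa%:E)%E by rewrite lee_fin ltW.
    exact: (@ge0_integralZl _ _ R lebesgue_measure setT measurableT (EFin \o phi)).
  by rewrite EFinM; apply: lee_pmul => //; rewrite lee_fin ?ltW.
rewrite /curve_length [leRHS]integral_mkcond; apply: le_ge0_integral => t _.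
  by rewrite -EFinM lee_fin mulr_ge0 // ltW.
rewrite -EFinM patchE; have [e|/phiS[/andP[t0 t1] dc le]] := eqVneq (phi t) 0.
  by rewrite e mulr0; case: ifP => // _; rewrite lee_fin sqrtr_ge0.
have t01 : t \in `[0%R, 1%R]%classic by rewrite inE /= in_itv /= !ltW.
rewrite t01 lee_fin.
have Mt : M (c t) by apply: Mc; rewrite !ltW.
have nMc : \forall s \near t, M (c s).
  have tb : t \in `]0, 1[%R by rewrite in_itv /= t0 t1.
  apply: filterS (near_in_itvoo tb) => r; rewrite in_itv /= => /andP[r0 r1].
  by apply: Mc; rewrite !ltW.
have tg := tangent_velocity dc nMc.
rewrite gE //; apply: (@le_trans _ _ (kappa * `|derive1 c t 0 k|)).
  by rewrite ler_pM2l.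
have -> : kappa * `|derive1 c t 0 k| = Num.sqrt (kappa ^+ 2 * derive1 c t 0 k ^+ 2).
  by rewrite sqrtrM ?sqr_ge0 // !sqrtr_sqr (gtr0_norm k0).
apply: ler_wsqrtr; apply: ler_pM; rewrite ?sqr_ge0 ?kw //.
rewrite /dot (bigD1 k) //= expr2 lerDl; apply: sumr_ge0 => i _.
by rewrite -expr2 sqr_ge0.
Qed.

End DistanceBounds.

(** * Arcs running into a puncture *)

Section StereoLine.
Variables (R : realType) (n : nat) (b : bool) (x : 'rV[R]_n) (i : 'I_n).

Definition ray (r : R) : 'rV[R]_n.+1 := stereo b (x + r *: delta_mx 0 i).

(** The derivative is computed coordinatewise; its continuity follows from the
differentiability of the first partial derivatives of the chart. *)
Lemma C1_ray (r s : R) (c := fun t : R => ray (r + t * (s - r))) :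
  [/\ forall t, derivable c t 1, continuous (derive1 c) &
    forall t, derive1 c t =
      (s - r) *: 'D_(delta_mx 0 i) (stereo b) (x + (r + t * (s - r)) *: delta_mx 0 i)].
Proof.
pose F k (y : 'rV[R]_n) : R := stereo b y 0 k.
have sF k : smooth_on setT (F k) := smooth_stereo_coord b k.
have dF k y : differentiable (F k) y.
  exact: (@smooth_on_differentiable _ _ setT _ y (sF k) I).
have dpF k y : differentiable (partial i (F k)) y.
  exact: (@smooth_on_differentiable _ _ setT _ y (smooth_on_partial i (sF k)) I).
pose y0 := x + r *: delta_mx 0 i; pose v : 'rV[R]_n := (s - r) *: delta_mx 0 i.
have lineE t : x + (r + t * (s - r)) *: delta_mx 0 i = y0 + t *: v.
  by rewrite /y0 /v scalerA scalerDl addrA.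
have dck (t : R) k : is_derive t 1 (fun t : R => c t 0 k : R) ((s - r) * partial i (F k) (y0 + t *: v)).
  have h := is_derive_line (dF k (y0 + t *: v)).
  have e : (fun t : R => c t 0 k) = (fun t : R => F k (y0 + t *: v)).
    by apply/funext => z; rewrite /c /ray lineE.
  rewrite e (_ : _ * _ = 'D_v (F k) (y0 + t *: v)) //.
  by rewrite /partial !deriveE // /v; set y := y0 + _; rewrite [RHS]linearZ.
have dc t : derivable c t 1.
  apply/derivable_mxP => a k; rewrite ord1.
  exact: (@ex_derive _ _ _ _ _ _ _ (dck t k)).
have d1 t k : derive1 c t 0 k = (s - r) * partial i (F k) (y0 + t *: v).
  by rewrite derive1E derive_mx // mxE; apply: derive_val; exact: dck.
split; [exact: dc | move=> t | move=> t].
  apply: differentiable_continuous; apply: differentiable_rV => k.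
  rewrite (_ : (fun _ => _) = fun t => (s - r) * partial i (F k) (y0 + t *: v)); last first.
    by apply/funext => z; exact: d1.
  apply: differentiableM; first exact: differentiable_cst.
  by apply/derivable1_diffP; case: (is_derive_line (dpF k (y0 + t *: v))).
apply/rowP => k; rewrite d1 lineE mxE; congr (_ * _).
have dS := differentiable_stereo b (y0 + t *: v).
by rewrite derive_mx ?mxE //; exact: diff_derivable.
Qed.

Variables (M : set 'rV[R]_n.+1) (g : tensor_field R n) (w : 'rV[R]_n.+1 -> R).
Hypothesis gE : tensor_eq_on M g (fun x v z => w x * dot v z).

(** Use the image of the segment itself: its velocity has Euclidean length at most
2 |s - r|, since the factor 4 / (1 + |x|^2)^2 is at most 4. *)
Lemma distance_ray_le (C r s : R) : 0 <= C ->
  (forall t, 0 <= t <= 1 -> M (ray (r + t * (s - r))) /\ w (ray (r + t * (s - r))) <= C ^+ 2) ->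
  (riemannian_distance M g (ray r) (ray s) <= (2 * C * `|s - r|)%:E)%E.
Proof.
move=> C0 h; have [dc cc c1] := C1_ray r s; set c := fun t : R => ray (r + t * (s - r)).
apply: (@le_trans _ _ (curve_length g c)).
  apply: ereal_inf_lbound; exists c; [split|by []].
  - exists [:: 1]; split; [by rewrite /= ltr01 | by [] |].
    move=> [|//] _; exists c; split; [exact: dc | exact: cc | by []].
  - by move=> t /h[].
  - by rewrite /c mul0r addr0.
  - by rewrite /c mul1r addrC subrK.
rewrite /curve_length.
apply: (@le_trans _ _ (\int[lebesgue_measure]_(t in `[0%R, 1%R]) (cst (2 * C * `|s - r|)%:E) t)%E).
  apply: le_ge0_integral => t; first by rewrite lee_fin sqrtr_ge0.
  rewrite /= in_itv /= => /h[Mt wt]; rewrite lee_fin.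
  have -> : 2 * C * `|s - r| = Num.sqrt (C ^+ 2 * (4 * (s - r) ^+ 2)).
    have -> : C ^+ 2 * (4 * (s - r) ^+ 2) = (2 * C * (s - r)) ^+ 2 by ring.
    by rewrite sqrtr_sqr normrM (@ger0_norm _ (2 * C)) // mulr_ge0.
  apply: ler_wsqrtr.
  have tg : tangent (c t) (derive1 c t).
    by rewrite /tangent /= c1 dotZr tangent_derive_stereo mulr0.
  rewrite gE //.
  have -> : dot (derive1 c t) (derive1 c t) =
      (s - r) ^+ 2 * (4 / (dot (x + (r + t * (s - r)) *: delta_mx 0 i)
        (x + (r + t * (s - r)) *: delta_mx 0 i) + 1) ^+ 2).
    by rewrite c1 dotZr dotZl dot_derive_stereo eqxx mul1r; ring.
  set N := dot _ _; have N1 : 1 <= N + 1 by rewrite lerDr dot_ge0.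
  apply: (@le_trans _ _ (C ^+ 2 * ((s - r) ^+ 2 * (4 / (N + 1) ^+ 2)))).
    by apply: ler_wpM2r => //; rewrite mulr_ge0 ?sqr_ge0 // divr_ge0 // sqr_ge0.
  apply: ler_wpM2l; first exact: sqr_ge0.
  rewrite mulrC; apply: ler_wpM2r; first exact: sqr_ge0.
  rewrite ler_pdivrMr ?exprn_gt0 ?(lt_le_trans ltr01) //.
  by rewrite ler_peMr // exprn_ege1.
rewrite integral_cst; last exact: measurable_itv.
have e := @lebesgue_measure_itv R `[0%R, 1%R].
rewrite /= lte_fin ltr01 oppr0 adde0 in e.
by rewrite [X in (_ * X)%E]e mule1.
Qed.

End StereoLine.

(** * Completeness *)

Section Completeness.
Variables (R : realType) (n k : nat) (n0 : (0 < n)%N) (p : 'I_k -> 'rV[R]_n.+1).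
Hypothesis p_sphere : forall i, sphere R n (p i).
Let M := sphere R n `\` range p.
Variables (g : tensor_field R n) (w q : 'rV[R]_n.+1 -> R).
Hypotheses (gE : tensor_eq_on M g (fun x v z => w x * dot v z)).
Hypotheses (w_gt0 : forall x, M x -> 0 < w x) (reg_q : regular q).
Hypothesis qw : forall x, M x -> q x * w x = 1.

(** A polynomial is bounded on the sphere, and w is the reciprocal of q. *)
Lemma conformal_factor_lower_bound :
  exists2 kappa, 0 < kappa & forall x, M x -> kappa ^+ 2 <= w x.
Proof.
have [_ [C hC]] := reg_q.
have C1 : 0 < `|C| + 1 by rewrite ltr_wpDl.
exists (Num.sqrt (`|C| + 1)^-1); first by rewrite sqrtr_gt0 invr_gt0.
move=> x Mx; rewrite sqr_sqrtr; last by rewrite invr_ge0 ltW.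
have w0 := w_gt0 Mx.
have h : q x <= `|C| + 1.
  by have := hC x Mx.1; have := ler_norm (q x); have := ler_norm C; lra.
rewrite -(ler_pM2l C1) mulfV ?gt_eqF // -[X in X <= _](qw Mx).
by rewrite ler_pM2r.
Qed.

(** The puncture is at a finite point x of one of the two charts. Near x the function q
stays away from zero by continuity, so w is bounded, and there is no other puncture. *)
Lemma ray_into_puncture i : q (p i) != 0 ->
  exists (b : bool) (x : 'rV[R]_n) (r0 C : R) (j : 'I_n),
    [/\ stereo b x = p i, 0 < r0, 0 <= C &
      forall r, 0 < r <= r0 -> M (ray b x j r) /\ w (ray b x j r) <= C ^+ 2].
Proof.
move=> qi; pose b := p i 0 ord0 == 1.
have pb : (-1) ^+ b * p i 0 ord0 != 1.
  rewrite /b; case: (p i 0 ord0 =P 1) => [->|/eqP h] /=; last by rewrite expr0 mul1r.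
  by rewrite expr1 mulr1 eq_sym -subr_eq0 opprK -[1 + 1]/(2%:R) pnatr_eq0.
pose x := unstereo b (p i).
have xE : stereo b x = p i by apply: unstereoK => //; exact: p_sphere.
pose j : 'I_n := Ordinal n0.
(* On the part of the ray that is kept, q exceeds eta. *)
pose eta := `|q (p i)| / 2.
have eta0 : 0 < eta by rewrite divr_gt0 // normr_gt0.
have cq : {for x, continuous (q \o stereo b)}.
  apply: differentiable_continuous; apply: differentiable_comp.
    exact: differentiable_stereo.
  exact: reg_q.1.
pose A (y : 'rV[R]_n) : Prop := `|(q \o stereo b) x - (q \o stereo b) y| < eta.
have nA : nbhs x A by move: cq => /cvgrPdist_lt/(_ _ eta0).
pose B : set 'rV[R]_n := [set y | y \notin [seq z <- punctures p b | z != x]].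
have Bx : B x by rewrite /B /= mem_filter eqxx.
have nB : nbhs x B by exact: open_nbhs_nbhs (conj (@open_notin R n _) Bx).
have [r0 r00 hr] := nbhs_segment (delta_mx 0 j) (filterI nA nB).
exists b, x, r0, (Num.sqrt eta^-1), j; split; rewrite ?sqrtr_ge0 // => r rr0.
have [r_gt0 _] := andP rr0.
have [Ar Br] := hr r rr0.
have Mr : M (ray b x j r).
  apply/(stereo_preimage p_sphere); move: Br; rewrite /B /= mem_filter negb_and negbK.
  move=> /orP[/eqP h|//]; exfalso.
  have := congr1 (fun v : 'rV[R]_n => v 0 j) h.
  rewrite !mxE !eqxx mulr1 => /eqP; rewrite -subr_eq0 addrAC subrr add0r => /eqP r_eq0.
  by move: r_gt0; rewrite r_eq0 ltxx.
split; first exact: Mr.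
have w0 := w_gt0 Mr; have qw1 := qw Mr.
rewrite sqr_sqrtr; last by rewrite invr_ge0 ltW.
have q_eta : eta <= q (ray b x j r).
  have q0 : 0 < q (ray b x j r) by rewrite -(pmulr_lgt0 _ w0) qw1.
  rewrite -[leRHS]gtr0_norm //.
  move: Ar; rewrite /A /= xE -/(ray b x j r) => h.
  have := ler_distD (q (ray b x j r)) (q (p i)) 0; rewrite !subr0.
  have : `|q (p i)| = eta + eta by rewrite /eta; lra.
  by move: h; lra.
by rewrite -(ler_pM2l eta0) mulfV ?gt_eqF // -[X in _ <= X]qw1 ler_pM2r.
Qed.

(** The points X m at parameter r0 / (m + 1) on a ray into p i form a Cauchy sequence.
Its limit would have the same coordinates as p i by [coord_le_distance]. *)
Lemma complete_zero i : complete_metric M g -> q (p i) = 0.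
Proof.
move=> cM; apply/eqP; apply/negPn/negP => /ray_into_puncture.
move=> [b [x [r0 [C [j [xE r00 C0 hr]]]]]].
have [kappa kappa0 hk] := conformal_factor_lower_bound.
pose r (m : nat) := r0 / m.+1%:R.
have r_gt0 m : 0 < r m by rewrite divr_gt0.
have r_le m m' : (m <= m')%N -> r m' <= r m.
  by move=> mm; rewrite ler_pM2l // lef_pV2 ?posrE ?ltr0n // ler_nat.
have r_le0 m : r m <= r0 by rewrite ler_pdivrMr // ler_peMr ?ler1n // ltW.
pose X m := ray b x j (r m).
have XM m : M (X m) by have [] := hr (r m) _; rewrite ?r_gt0 ?r_le0.
have dX m m' N : (N <= m)%N -> (N <= m')%N ->
    (riemannian_distance M g (X m) (X m') <= (2 * C * r N)%:E)%E.
  move=> Nm Nm'; apply: le_trans (distance_ray_le (C := C) gE C0 _) _.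
    move=> t /andP[t0 t1]; apply: hr.
    have e : r m + t * (r m' - r m) = (1 - t) * r m + t * r m' by ring.
    rewrite e; apply/andP; split.
      have [->|tn0] := eqVneq t 0; first by rewrite subr0 mul1r mul0r addr0.
      apply: ltr_wpDl; last by rewrite mulr_gt0 // lt_neqAle eq_sym tn0.
      by rewrite mulr_ge0 ?subr_ge0 // ltW.
    have h1 : (1 - t) * r m <= (1 - t) * r0 by rewrite ler_wpM2l ?subr_ge0.
    have h2 : t * r m' <= t * r0 by rewrite ler_wpM2l.
    by move: h1 h2; rewrite mulrBl mul1r; lra.
  rewrite lee_fin ler_wpM2l ?mulr_ge0 // ler_norml.
  have := r_le _ _ Nm; have := r_le _ _ Nm'; have := r_gt0 m; have := r_gt0 m'.
  by move=> *; apply/andP; split; lra.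
have small (e : R) : 0 < e -> exists N, r N < e.
  move=> e0; have h : 0 <= r0 / e by rewrite divr_ge0 ?ltW.
  exists (Num.bound (r0 / e)); rewrite ltr_pdivrMr // mulrC -ltr_pdivrMr //.
  by apply: lt_trans (archi_boundP h) _; rewrite ltr_nat.
have [l Ml hl] : exists2 l, M l & forall e : R, 0 < e -> exists N : nat, forall i : nat,
    (N <= i)%N -> (riemannian_distance M g (X i) l < e%:E)%E.
  apply: cM => // e e0.
  have e0' : 0 < e / (2 * C + 1) by rewrite divr_gt0 // ltr_wpDl // mulr_ge0.
  have [N hN] := small _ e0'; exists N => m m' Nm Nm'.
  apply: le_lt_trans (dX _ _ _ Nm Nm') _; rewrite lte_fin.
  move: hN; rewrite ltr_pdivlMr ?ltr_wpDl ?mulr_ge0 // mulrDr mulr1 mulrC.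
  by have := r_gt0 N; lra.
have lE : l = p i.
  apply/rowP => a; apply/eqP; rewrite -subr_eq0 -normr_le0.
  apply/ler_addgt0Pr => e e0; rewrite add0r.
  have e20 : 0 < e / 2 by rewrite divr_gt0.
  have cS : {for x, continuous (fun y : 'rV[R]_n => stereo b y 0 a)}.
    apply: differentiable_continuous.
    exact: (@smooth_on_differentiable _ _ setT _ x (smooth_stereo_coord b a) I).
  have nA : nbhs x [set y : 'rV[R]_n | `|stereo b x 0 a - stereo b y 0 a| < e / 2].
    by move: cS => /cvgrPdist_lt/(_ _ e20).
  have [d d0 hd] := nbhs_segment (delta_mx 0 j) nA.
  have [N1 hN1] := small d d0.
  have [N2 hN2] := hl (kappa * (e / 2)) (mulr_gt0 kappa0 e20).
  pose N := maxn N1 N2.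
  have h2 := hN2 N (leq_maxr _ _).
  have MS z : M z -> dot z z = 1 by case.
  have := le_lt_trans (coord_le_distance MS gE a (X N) l kappa0 hk) h2.
  rewrite lte_fin ltr_pM2l // => h3.
  have rN : 0 < r N <= d.
    by rewrite r_gt0 ltW // (le_lt_trans (r_le _ _ (leq_maxl _ _)) hN1).
  have := hd _ rN; rewrite /= xE -/(ray b x j (r N)) -/(X N) => h4.
  have := ler_distD (X N 0 a) (l 0 a) (p i 0 a).
  by rewrite (distrC (X N 0 a) (p i 0 a)); lra.
by case: Ml => _; apply; exists i.
Qed.

End Completeness.

(** * Quadratic polynomials with three zeros on the sphere *)

Section ThreeZeros.
Variables (R : realType) (m : nat).
Implicit Types (p : 'rV[R]_m.+1) (q : 'rV[R]_m.+1 -> R).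

Lemma dot_lt1 p p' : dot p p = 1 -> dot p' p' = 1 -> p != p' -> 0 < 1 - dot p p'.
Proof.
move=> h h' pp'.
have e : dot (p - p') (p - p') = 2 * (1 - dot p p').
  by rewrite -scaleN1r !(dotDl, dotDr, dotZl, dotZr) h h' (dotC p' p); ring.
rewrite -(pmulr_rgt0 _ (ltr0Sn _ 1)) -[2%:R]/2 -e lt_neqAle dot_ge0 andbT eq_sym.
by apply: contra pp' => /eqP /dot_eq0 /eqP; rewrite subr_eq0.
Qed.

Variables (q : 'rV[R]_m.+1 -> R) (quad_q : quadratic q).
Hypothesis q_ge0 : forall p, dot p p = 1 -> 0 <= q p.
Variables (p1 p2 p3 : 'rV[R]_m.+1).
Hypotheses (s1 : dot p1 p1 = 1) (s2 : dot p2 p2 = 1) (s3 : dot p3 p3 = 1).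
Hypotheses (n12 : p1 != p2) (n13 : p1 != p3) (n23 : p2 != p3).
Hypotheses (q1 : q p1 = 0) (q2 : q p2 = 0) (q3 : q p3 = 0).

Let d1 := 1 - dot p2 p3.
Let d2 := 1 - dot p1 p3.
Let d3 := 1 - dot p1 p2.
Let d1_gt0 : 0 < d1. Proof. exact: dot_lt1. Qed.
Let d2_gt0 : 0 < d2. Proof. exact: dot_lt1. Qed.
Let d3_gt0 : 0 < d3. Proof. exact: dot_lt1. Qed.

Definition weight_sum (x y z : R) := d1 * y * z + d2 * x * z + d3 * x * y.
(** The null vectors of the Lorentzian space spanned by (1, p1), (1, p2), (1, p3) have
coordinates (a, b, c) with a b d3 + a c d2 + b c d1 = 0. The substitution a = d1 y z,
b = d2 x z, c = d3 x y turns this into x y z (x + y + z) = 0, so the line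
x + y + z = 0 parametrizes the circle through the three points. *)
Definition circle_point (x y z : R) :=
  bary p1 p2 p3 (d1 * y * z) (d2 * x * z) (d3 * x * y).

(** A null vector with time component 0 vanishes; but three distinct points of the
sphere are not collinear. *)
Lemma weight_sum_neq0 x y z : x + y + z = 0 -> x != 0 -> y != 0 -> z != 0 ->
  weight_sum x y z != 0.
Proof.
move=> xyz x0 y0 z0; apply/eqP => s0.
pose v := (d1 * y * z) *: p1 + (d2 * x * z) *: p2.
have h : dot (v + (d3 * x * y) *: p3) (v + (d3 * x * y) *: p3) = 0.
  rewrite /v !(dotDl, dotDr, dotZl, dotZr) s1 s2 s3 (dotC p2 p1) (dotC p3 p1) (dotC p3 p2).
  have -> : dot p1 p2 = 1 - d3 by rewrite /d3; ring.
  have -> : dot p1 p3 = 1 - d2 by rewrite /d2; ring.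
  have -> : dot p2 p3 = 1 - d1 by rewrite /d1; ring.
  transitivity (weight_sum x y z ^+ 2 - 2 * d1 * d2 * d3 * x * y * z * (x + y + z)).
    by rewrite /weight_sum; ring.
  by rewrite s0 xyz; ring.
have : dot v v = (d3 * x * y) ^+ 2.
  have e := dot_eq0 h.
  move/eqP: e; rewrite addr_eq0 => /eqP ->.
  by rewrite -scaleN1r !(dotZl, dotZr) s3; ring.
rewrite /v !(dotDl, dotDr, dotZl, dotZr) s1 s2 (dotC p2 p1).
have -> : dot p1 p2 = 1 - d3 by rewrite /d3; ring.
have -> : d3 * x * y = - (d1 * y * z + d2 * x * z).
  by apply/eqP; rewrite -addr_eq0 addrC -/(weight_sum x y z) s0.
move=> H; have : 2 * d1 * d2 * d3 * x * y * z * z = 0.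
  transitivity ((- (d1 * y * z + d2 * x * z)) ^+ 2 - (- (d1 * y * z + d2 * x * z)) ^+ 2
     + 2 * d1 * d2 * d3 * x * y * z * z); first by ring.
  by rewrite -{1}H; ring.
by apply/eqP; rewrite !mulf_neq0 // ?pnatr_eq0 // gt_eqF.
Qed.

Lemma circle_point_sphere x y z : x + y + z = 0 -> x != 0 -> y != 0 -> z != 0 ->
  dot (circle_point x y z) (circle_point x y z) = 1.
Proof.
move=> xyz x0 y0 z0; have s0 := weight_sum_neq0 xyz x0 y0 z0.
rewrite /circle_point /bary -/(weight_sum x y z) dotZl dotZr.
rewrite !(dotDl, dotDr, dotZl, dotZr) s1 s2 s3 (dotC p2 p1) (dotC p3 p1) (dotC p3 p2).
have -> : dot p1 p2 = 1 - d3 by rewrite /d3; ring.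
have -> : dot p1 p3 = 1 - d2 by rewrite /d2; ring.
have -> : dot p2 p3 = 1 - d1 by rewrite /d1; ring.
set D := (X in _ * (_ * X)).
have -> : D = weight_sum x y z ^+ 2 - 2 * d1 * d2 * d3 * x * y * z * (x + y + z).
  by rewrite /D /weight_sum; ring.
by rewrite xyz mulr0 subr0 expr2; field.
Qed.

(** At the parameter (x, y, z) the homogenized form equals x y z times a linear form l,
because its diagonal terms vanish at the three points. On the three cyclic
permutations of (x, y, z) the product x y z is the same and negative, so l is
nonpositive there; but the sum of its three values is a multiple of x + y + z = 0. *)
Lemma three_zeros x y z : x + y + z = 0 -> 0 < x -> 0 < y -> z < 0 ->
  q (circle_point x y z) = 0.
Proof.
move=> xyz x_gt0 y_gt0 z_lt0.
have x0 : x != 0 by rewrite gt_eqF.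
have y0 : y != 0 by rewrite gt_eqF.
have z0 : z != 0 by rewrite lt_eqF.
have [B12 [B13 [B23 hB]]] := quad_q.2 p1 p2 p3.
pose l x y z := d1 * d2 * B12 * z + d1 * d3 * B13 * y + d2 * d3 * B23 * x.
have E a b c : a + b + c = 0 -> a != 0 -> b != 0 -> c != 0 ->
    weight_sum a b c ^+ 2 * q (circle_point a b c) = a * b * c * l a b c.
  move=> abc a0 b0 c0; rewrite hB ?weight_sum_neq0 // q1 q2 q3 /l; ring.
have le0 a b c : a + b + c = 0 -> a != 0 -> b != 0 -> c != 0 -> a * b * c < 0 -> l a b c <= 0.
  move=> abc a0 b0 c0 neg.
  rewrite -(nmulr_rge0 _ neg) -E // mulr_ge0 ?sqr_ge0 //.
  by apply/q_ge0/circle_point_sphere.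
have xyz_lt0 : x * y * z < 0 by rewrite pmulr_rlt0 ?mulr_gt0.
have yzx : y + z + x = 0 by rewrite -xyz; ring.
have zxy : z + x + y = 0 by rewrite -xyz; ring.
have h1 := le0 _ _ _ xyz x0 y0 z0 xyz_lt0.
have h2 : l y z x <= 0 by apply: le0 => //; rewrite -mulrA mulrC [z * x]mulrC mulrAC.
have h3 : l z x y <= 0 by apply: le0 => //; rewrite -mulrA mulrC.
have sum0 : l x y z + l y z x + l z x y = 0.
  transitivity ((d1 * d2 * B12 + d1 * d3 * B13 + d2 * d3 * B23) * (x + y + z)).
    by rewrite /l; ring.
  by rewrite xyz mulr0.
have l0 : l x y z = 0.
  by apply/eqP; rewrite eq_le h1 /=; move: sum0 h2 h3; lra.
have := E _ _ _ xyz x0 y0 z0; rewrite l0 mulr0 => /eqP.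
by rewrite mulf_eq0 expf_eq0 /= (negbTE (weight_sum_neq0 xyz x0 y0 z0)) => /eqP.
Qed.

Lemma dot_circle_point x y z : x + y + z = 0 -> x != 0 -> y != 0 -> z != 0 ->
  1 - dot (circle_point x y z) p2 = - (d1 * d3 * y ^+ 2 / weight_sum x y z).
Proof.
move=> xyz x0 y0 z0; have s0 := weight_sum_neq0 xyz x0 y0 z0.
rewrite /circle_point /bary -/(weight_sum x y z) dotZl !dotDl !dotZl s2 (dotC p3 p2).
have -> : dot p1 p2 = 1 - d3 by rewrite /d3; ring.
have -> : dot p2 p3 = 1 - d1 by rewrite /d1; ring.
have -> : y ^+ 2 = - (x + z) * y.
  have yE : y = - (x + z) by apply/eqP; rewrite -addr_eq0 addrCA addrA xyz.
  by rewrite expr2 {1}yE.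
move: s0; rewrite /weight_sum => s0; field; exact: s0.
Qed.

(** The parameter (1, t, - 1 - t) tends to (1, 0, -1), which represents p2, as t > 0
tends to 0; by [dot_circle_point] the distance to p2 is of order t and nonzero for
t > 0. The bounds on t keep the normalization below - d2 / 2. *)
Lemma zeros_cluster e : 0 < e ->
  exists p, [/\ dot p p = 1, q p = 0, p != p2 & 1 - dot p p2 < e].
Proof.
move=> e0.
pose t := Num.min 1 (Num.min (d2 / (2 * (d3 + 1))) (e * d2 / (2 * (d1 * d3 + 1)))).
have D3 : 0 < 2 * (d3 + 1) by rewrite mulr_gt0 // addr_gt0.
have D13 : 0 < 2 * (d1 * d3 + 1) by rewrite mulr_gt0 // addr_gt0 // mulr_gt0.
have t0 : 0 < t by rewrite !lt_min ltr01 !divr_gt0 // mulr_gt0.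
have t1 : t <= 1 by rewrite ge_min lexx.
have t2 : t * (2 * (d3 + 1)) <= d2.
  by rewrite -ler_pdivlMr // !ge_min lexx !orbT.
have t3 : t * (2 * (d1 * d3 + 1)) <= e * d2.
  by rewrite -ler_pdivlMr // !ge_min lexx !orbT.
have z0 : - 1 - t < 0 by rewrite -opprD oppr_lt0 addr_gt0.
have xyz : 1 + t + (- 1 - t) = 0 by ring.
have n1 : (1 : R) != 0 by rewrite oner_eq0.
have n2 : t != 0 by rewrite gt_eqF.
have n3 : - 1 - t != 0 by rewrite lt_eqF.
have W : weight_sum 1 t (- 1 - t) <= - (d2 / 2).
  have h1 : 0 <= d1 * t * (1 + t) by apply/ltW/mulr_gt0; [exact: mulr_gt0 | exact: addr_gt0].
  have h2 : 0 <= d2 * t by apply/ltW/mulr_gt0.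
  rewrite /weight_sum.
  have -> : d1 * t * (- 1 - t) + d2 * 1 * (- 1 - t) + d3 * 1 * t =
     - (d1 * t * (1 + t)) - d2 - d2 * t + d3 * t by ring.
  move: t2 h1 h2 (ltW t0); rewrite mulrCA (mulrDr t) mulr1 (mulrC d3).
  move: (t * d3) (d1 * t * (1 + t)) (d2 * t) => a b c *; lra.
have W0 : weight_sum 1 t (- 1 - t) < 0.
  by apply: le_lt_trans W _; rewrite oppr_lt0 divr_gt0.
have dE := dot_circle_point xyz n1 n2 n3.
exists (circle_point 1 t (- 1 - t)); split.
- exact: circle_point_sphere.
- exact: three_zeros.
- apply/eqP => pE; move: dE; rewrite pE s2 subrr => /esym/eqP; rewrite oppr_eq0.
  apply/negP; rewrite mulf_neq0 ?invr_eq0 ?(lt_eqF W0) //.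
  by rewrite !mulf_neq0 ?expf_neq0 ?gt_eqF.
- rewrite dE -mulrN -invrN ltr_pdivrMr ?oppr_gt0 //.
  have h : d1 * d3 * t ^+ 2 <= d1 * d3 * t.
    by rewrite ler_pM2l ?mulr_gt0 // expr2 ger_pMr.
  apply: (le_lt_trans h); apply: (@lt_le_trans _ _ (e * (d2 / 2))); last first.
    by rewrite ler_pM2l // lerNr.
  have -> : e * (d2 / 2) = (e * d2) / 2 by ring.
  have e3 : t * (2 * (d1 * d3 + 1)) = 2 * (d1 * d3 * t) + 2 * t by ring.
  move: t3 t0; rewrite e3; move: (e * d2) (d1 * d3 * t) => a b *; lra.
Qed.

End ThreeZeros.

(** * Conclusion *)

Theorem mainTheorem5 (R : realType) (n k : nat) (hn : (3 <= n)%N)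
    (hk : (2 < k)%N) (p : 'I_k -> 'rV[R]_n.+1) (p_inj : injective p)
    (p_sphere : forall i, sphere R n (p i))
    (g : tensor_field R n)
    (g_conformal : conformal_to_standard (sphere R n `\` range p) g)
    (g_complete : complete_metric (sphere R n `\` range p) g)
    (c : R) (c_gt0 : 0 < c)
    (g_scal : has_constant_scalar_curvature (sphere R n `\` range p) g c)
    (g_not_standard :
      ~ tensor_eq_on (sphere R n `\` range p) g (standard_metric R n)) :
  ~ parallel_ricci (sphere R n `\` range p) g.
Proof.
move=> par; have [u [u_smooth u_gt0 gE]] := g_conformal.
have [q quad_q qw] := conformal_factor_quadratic hn p_sphere u_smooth u_gt0 gE par.
set w := fun x => u x `^ (4 / (n%:R - 2)) in qw.
have w_gt0 x : (sphere R n `\` range p) x -> 0 < w x.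
  by move=> Mx; exact/powR_gt0/u_gt0.
have q_gt0 x : (sphere R n `\` range p) x -> 0 < q x.
  by move=> Mx; rewrite -(pmulr_lgt0 _ (w_gt0 x Mx)) qw.
have n_gt0 : (0 < n)%N by exact: ltn_trans hn.
have qp i : q (p i) = 0.
  exact: (complete_zero n_gt0 p_sphere gE w_gt0 quad_q.1 qw i g_complete).
have q_ge0 x : dot x x = 1 -> 0 <= q x.
  move=> Sx; have [[i _ <-]|nx] := pselect (range p x); first by rewrite qp.
  by apply/ltW/q_gt0.
pose i1 : 'I_k := Ordinal (ltnW (ltnW hk)).
pose i2 : 'I_k := Ordinal (ltnW hk).
pose i3 : 'I_k := Ordinal hk.
have n12 : p i1 != p i2 by rewrite (inj_eq p_inj).
have n13 : p i1 != p i3 by rewrite (inj_eq p_inj).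
have n23 : p i2 != p i3 by rewrite (inj_eq p_inj).
(* The other punctures keep a positive distance e from p i2. *)
have [e e0 he] : exists2 e : R, 0 < e & forall i, p i != p i2 -> e <= 1 - dot (p i) (p i2).
  exists (\big[Num.min/1]_(i | p i != p i2) (1 - dot (p i) (p i2))).
    elim/big_ind: _ => // [x y x0 y0|i ni]; first by rewrite lt_min x0.
    by apply: dot_lt1 => //; exact: p_sphere.
  by move=> i ni; exact: bigmin_le_cond.
have [x [Sx qx xp xe]] := zeros_cluster quad_q q_ge0 (p_sphere i1) (p_sphere i2)
  (p_sphere i3) n12 n13 n23 (qp i1) (qp i2) (qp i3) e0.
have [[i _ xE]|nx] := pselect (range p x).
  by move: xp xe; rewrite -xE => /he; rewrite leNgt => /negP.
by have := q_gt0 x (conj Sx nx); rewrite qx ltxx.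
Qed.
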